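(* Let $n\ge1$ and $\mathbf{w}\in\mathbb{Z}_{\ge0}^n$. For all $Y\in\mathbf{P}(\mathbf{w})$, we have $\mathsf{T}(Y)=\mathsf{T}'(Y)$.
   Context: **Triangular arrays.** For $\mathbf{w}=(w_1,\dots,w_n)\in\mathbb{Z}_{\ge0}^n$, $\mathbf{P}(\mathbf{w})$ is the set of triangular arrays of size $n$, $Y=(y_{ij})_{1\le i\le n,\,1\le j\le n-i+1}$ of nonnegative integers, with $\sum_{j}y_{ij}=w_i$ for all $i$ and $y_{ij}\ge y_{i-1,j+1}$ for all $i\ge2$ and all $j$. If $Y\in\mathbf{P}(\mathbf{w})$ write $\underline{\dim}(Y)=\mathbf{w}$. Write $\mathbf{w}^*=(w_n,\dots,w_1)$. **Elementary operations.** Let $Y$ be a triangular array of size $n$. - $\mathsf{Del}^{\searrow}(Y)$: array of size $n-1$ with $(i,j)$ entry $y_{i+1,j}$ (top chute deleted). $\mathsf{Del}_{\nearrow}(Y)$: array of size $n-1$ with $(i,j)$ entry $y_{ij}$, $1\le j\le n-i$ (last ladder deleted). $\mathrm{Top}(Y)=(y_{11},\dots,y_{1n})$ (the top chute). - For $Q=(q_1,\dots,q_{n+1})$ nonnegative integers with $q_j\le y_{1,j-1}$ for $2\le j\le n+1$, $Y\cup^{\searrow}Q$ is the array of size $n+1$ with $(i,j)$ entry $q_j$ if $i=1$ and $y_{i-1,j}$ if $i\ge2$. If instead $q_1\ge\cdots\ge q_{n+1}$, $Y\cup_{\nearrow}Q$ is the array of size $n+1$ with $(i,j)$ entry $y_{ij}$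 if $i\le n$ and $j\le n-i+1$, and $q_{n-i+2}$ if $j=n-i+2$, $1\le i\le n+1$. - $\mathrm{Raise}(Y,i,j)$ (resp. $\mathrm{Lower}(Y,i,j)$) replaces $y_{ij}$ by $y_{ij}+1$ (resp. $y_{ij}-1$). $\mathrm{Raise}$ is defined if $j=1$ or $y_{ij}<y_{i+1,j-1}$; $\mathrm{Lower}$ is defined if $i=1$ and $y_{1j}>0$, or $i>1$ and $y_{ij}>y_{i-1,j+1}$. **Invariants.** For $1\le k\le n$: $\mathcal{I}(Y,k)$ is the smallest $j\ge k$ (with $j\le n$) such that $y_{1j}>0$, or $\infty$ if none. $\mathcal{J}(Y,k)$ is the smallest $j>\mathcal{I}(Y,k)$ (with $j\le n$) such that $y_{1j}<y_{2,j-1}$, if $\mathcal{I}(Y,k)<\infty$ and such a $j$ exists; otherwise $\infty$. For $1\le i\le n-k+1$, $\mathcal{K}_i(Y,k)=\max(\{1\}\cup\{j\mid2\le j\le k,\ y_{ij}<y_{i+1,j-1}\})$. **Procedures.** - $\mathsf{a}(Y,i,k)=(\mathrm{Raise}(Y,i,\mathcal{K}_i(Y,k)),i-1,\mathcal{K}_i(Y,k))$ for $1\le i\le n$, $1\le k\le n-i+1$. - $\mathsf{A}_i(Y)$, $1\le i\le n$, is the array $X$ such that applying $\mathsf{a}$ $i$ times to $(Y,i,n-i+1)$ gives $(X,0,k)$ for some $k$. - $\mathsf{B}(Y,k)$, for $1\le k\le n$ with $\mathcal{I}(Y,k)<\infty$, is a pair (array of size $n$, integer) defined by induction on $n$: if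 $\mathcal{J}(Y,k)=\infty$ (in particular if $n=1$), $\mathsf{B}(Y,k)=(\mathrm{Lower}(Y,1,\mathcal{I}(Y,k)),1)$; if $j_0=\mathcal{J}(Y,k)<\infty$, let $(Z,r)=\mathsf{B}(\mathsf{Del}^{\searrow}(Y),j_0-1)$ and $\mathsf{B}(Y,k)=(\mathrm{Lower}(Z\cup^{\searrow}\mathrm{Top}(Y),1,\mathcal{I}(Y,k)),r+1)$. **Combinatorial Fourier transform $\mathsf{T}$.** By induction on $n$: $\mathsf{T}(Y)=Y$ if $n=1$; for $n>1$, $$\mathsf{T}(Y)=\mathsf{A}_n^{y_{1,n}}\mathsf{A}_{n-1}^{y_{2,n-1}-y_{1,n}}\cdots\mathsf{A}_1^{y_{n,1}-y_{n-1,2}}\big(\mathsf{T}(\mathsf{Del}_{\nearrow}(Y))\cup^{\searrow}(0,\dots,0)\big)$$ (composed right to left; $(0,\dots,0)$ has $n$ entries). **Inverse combinatorial Fourier transform $\mathsf{T}'$.** By induction on $n$: $\mathsf{T}'(Y)=Y$ if $n=1$. For $n>1$, let $(w_1,\dots,w_n)=\underline{\dim}(Y)$, put $Y^{(0)}=Y$ and $(Y^{(m)},q_m)=\mathsf{B}(Y^{(m-1)},1)$ for $m=1,\dots,w_1$ (the top chute of $Y^{(w_1)}$ is zero). Let $P=(p_1,\dots,p_n)$ with $p_j=\#\{m\mid q_m\ge j\}$. Then $\mathsf{T}'(Y)=\mathsf{T}'(\mathsf{Del}^{\searrow}(Y^{(w_1)}))\cup_{\nearrow}P$. Both $\mathsf{T}$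 and $\mathsf{T}'$ map $\mathbf{P}(\mathbf{w})$ to $\mathbf{P}(\mathbf{w}^* )$. *)

(* Defs.v *)
From mathcomp Require Import all_boot.
Set Implicit Arguments.
Unset Strict Implicit.
Unset Printing Implicit Defensive.

(* All indices (rows i, columns j, and k) are natural numbers counted from 1.
   The condition j <= n - i + 1 is written i + j <= n.+1. *)
Definition tri_index (n : nat) : Type :=
  {p : 'I_n.+1 * 'I_n.+1 | [&& 0 < p.1, 0 < p.2 & p.1 + p.2 <= n.+1]}.

(* Arrays of naturals of triangular shape. The inequalities between entries
   are not part of this type but of the predicate [in_P], so the elementary
   operations are total functions; outside the domain of definition of an
   operation its value is irrelevant. *)
Definition array (n : nat) : Type := {ffun tri_index n -> nat}.

Definition mkarray (n : nat) (f : nat -> nat -> nat) : array n :=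
  [ffun p : tri_index n => f (val p).1 (val p).2].

(* y_ij, with value 0 outside of the triangle: [inord] sends an index larger
   than n to 0, which is not the coordinate of any position. *)
Definition entry (n : nat) (Y : array n) (i j : nat) : nat :=
  oapp (Y : tri_index n -> nat) 0 (insub (inord i, inord j)).

Definition row_sum (n : nat) (Y : array n) (i : nat) : nat :=
  \sum_(1 <= j < n.+2 - i) entry Y i j.

Definition in_P (n : nat) (w : n.-tuple nat) (Y : array n) : Prop :=
  (forall i : 'I_n, row_sum Y i.+1 = tnth w i) /\
  (forall i j : nat, 2 <= i -> 1 <= j -> i + j <= n.+1 ->
     entry Y i.-1 j.+1 <= entry Y i j).

(* A row (q_1, q_2, ...) is a function nat -> nat of
   which only the relevant values are read. *)
Definition del_top (n : nat) (Y : array n.+1) : array n :=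
  mkarray n (fun i j => entry Y i.+1 j).

Definition del_ladder (n : nat) (Y : array n.+1) : array n :=
  mkarray n (fun i j => entry Y i j).

Definition top (n : nat) (Y : array n) : nat -> nat := entry Y 1.

Definition cup_top (n : nat) (Y : array n) (q : nat -> nat) : array n.+1 :=
  mkarray n.+1 (fun i j => if i == 1 then q j else entry Y i.-1 j).

Definition cup_ladder (n : nat) (Y : array n) (q : nat -> nat) : array n.+1 :=
  mkarray n.+1 (fun i j => if i + j == n.+2 then q j else entry Y i j).

Definition raise (n : nat) (Y : array n) (i j : nat) : array n :=
  mkarray n (fun a b =>
    if (a == i) && (b == j) then (entry Y a b).+1 else entry Y a b).

Definition lower (n : nat) (Y : array n) (i j : nat) : array n :=
  mkarray n (fun a b =>
    if (a == i) && (b == j) then (entry Y a b).-1 else entry Y a b).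

(* [None] stands for infinity. *)
Definition invI (n : nat) (Y : array n) (k : nat) : option nat :=
  ohead [seq j <- index_iota k n.+1 | 0 < entry Y 1 j].

Definition invJ (n : nat) (Y : array n) (k : nat) : option nat :=
  if invI Y k is Some i0 then
    ohead [seq j <- index_iota i0.+1 n.+1 | entry Y 1 j < entry Y 2 j.-1]
  else None.

Definition invK (n : nat) (Y : array n) (i k : nat) : nat :=
  maxn 1 (\max_(2 <= j < k.+1 | entry Y i j < entry Y i.+1 j.-1) j).

Definition proc_a (n : nat) (s : array n * nat * nat) : array n * nat * nat :=
  let: (Y, i, k) := s in (raise Y i (invK Y i k), i.-1, invK Y i k).

Definition proc_A (n : nat) (i : nat) (Y : array n) : array n :=
  (iter i (@proc_a n) (Y, i, n.+1 - i)).1.1.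

(* The values for n = 0 and for invI Y k = None are irrelevant. *)
Fixpoint proc_B (n : nat) : array n -> nat -> array n * nat :=
  match n return array n -> nat -> array n * nat with
  | 0 => fun Y _ => (Y, 0)
  | n'.+1 => fun Y k =>
      match invI Y k, invJ Y k with
      | None, _ => (Y, 0)
      | Some i0, None => (lower Y 1 i0, 1)
      | Some i0, Some j0 =>
          let: (Z, r) := proc_B (del_top Y) j0.-1 in
          (lower (cup_top Z (top Y)) 1 i0, r.+1)
      end
  end.

(* The number of times that A_i is applied in [fourier]. *)
Definition A_exponent (n : nat) (Y : array n) (i : nat) : nat :=
  if i == n then entry Y 1 n
  else entry Y (n.+1 - i) i - entry Y (n - i) i.+1.

(* The combinatorial Fourier transform T; in the fold, A_1 acts first. *)
Fixpoint fourier (n : nat) : array n -> array n :=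
  match n return array n -> array n with
  | 0 => fun Y => Y
  | n'.+1 => fun Y =>
      if n' == 0 then Y else
      foldl (fun X i => iter (A_exponent Y i) (proc_A i) X)
        (cup_top (fourier (del_ladder Y)) (fun _ => 0))
        (index_iota 1 n'.+2)
  end.

(* The pair (Y^(m), q_m); the value 0 of q_0 is never used. *)
Definition B_orbit (n : nat) (Y : array n) (m : nat) : array n * nat :=
  iter m (fun s => proc_B s.1 1) (Y, 0).

(* The inverse combinatorial Fourier transform T'. *)
Fixpoint inv_fourier (n : nat) : array n -> array n :=
  match n return array n -> array n with
  | 0 => fun Y => Y
  | n'.+1 => fun Y =>
      if n' == 0 then Y else
      let w1 := row_sum Y 1 in
      cup_ladder (inv_fourier (del_top (B_orbit Y w1).1))
        (fun j => count (fun m => j <= (B_orbit Y m).2) (index_iota 1 w1.+1))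
  end.

(* Main.v *)
Require Import Defs.
From mathcomp Require Import all_boot.
From mathcomp Require Import zify.
Set Implicit Arguments.
Unset Strict Implicit.
Unset Printing Implicit Defensive.

(** Read an array as a multisegment on {1, ..., n}: the entry y_ij is the number
    of segments [a, i + j - 1] with a <= i.  The inequalities between entries
    say that y_{i+1,j-1} - y_ij, the number of segments [i + 1, i + j - 1], is
    nonnegative.  Raising y_ij extends one of these segments to
    [i, i + j - 1], and for j = 1 it creates the segment [i, i].

    The two transforms agree because T' T = 1 and T T = 1, whence
    T Y = T' (T (T Y)) = T' Y.

    T' T = 1 ([fourierK]).  The operation A_k extends a longest segment starting
    at k + 1, then at each smaller start a longest one among those that end
    earlier; where there is none it creates a segment of length one.  B walks
    the same chain upwards from row 1, so it undoes A_k ([proc_B_proc_A]) as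
    soon as row 1 vanishes to the left of the position that A_k raises there.
    In the definition of T the indices k never decrease, and then the positions
    raised in row 1 move weakly to the left ([chain_proc_A_leq]); so the
    condition persists along the whole construction.  The iterates of B
    therefore return the indices k in
    reverse order, and the number of those that are >= j telescopes to the
    entry of the last ladder in column j ([sum_A_exponent]).

    T T = 1 ([fourier_involutive]).  Multisegments carry the crystal structure
    of type A_n: the operator f_i extends to i a segment starting at i + 1,
    selected by a bracketing rule, and eps_i counts the segments starting at i
    that stay unmatched.  The key fact is T f_i = f_{n+1-i} T
    ([fourier_crystal]).  Every nonzero array is some f_i of a smaller one
    ([crystal_surj]), so T T, which commutes with every f_i and fixes the zero
    array, is the identity.

    To get T f_i = f_{n+1-i} T, split off the last ladder of Y, which holds the
    longest segments: the tensor product rule says whether f_i acts on the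
    ladder or on the rest ([eps_ladder], [crystal_pos_ladder]).  On the side
    of T, with j = n + 1 - i, the operator f_j commutes with A_k for k > j and
    for k < j - 1, and also for k = j, while moving f_j across A_{j-1} lowers
    eps_j by one or, once eps_j = 0, turns A_{j-1} into A_j.  That is the same
    rule ([crystal_stage]).  These commutations involve three consecutive rows
    and reduce to one statement on sequences of integers
    ([insertion_free_pos]). *)

(** * Signature words on the positive integers *)

(** The default value 1 is the position of the segment of length one, which can
    always be created. *)
Fixpoint last_pos (u : nat -> nat) (k : nat) : nat :=
  if k is k'.+1 then if 0 < u k then k else last_pos u k' else 1.

(** The bracketing rule: in the word made of u_1 letters U, v_1 letters V, u_2
    letters U, v_2 letters V, and so on, each V is cancelled by a later U, and
    [excess u v k] letters V of the first k positions are left over.  When u_p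
    is the number of segments [j + 1, j + p - 1] and v_p that of the segments
    [j, j + p - 1], the total excess is eps_j. *)
Fixpoint excess (u v : nat -> nat) (k : nat) : nat :=
  if k is k'.+1 then (excess u v k' - u k) + v k else 0.

(** The last position with a U that cancels no V, on which the crystal operator
    acts; position 1 always qualifies, since new segments of length one are in
    unlimited supply. *)
Fixpoint free_pos (u v : nat -> nat) (k : nat) : nat :=
  if k is k'.+1 then if excess u v k' < u k then k else free_pos u v k' else 1.

Lemma last_posP u k :
  [/\ 1 <= last_pos u k, last_pos u k <= maxn 1 k,
      1 < last_pos u k -> 0 < u (last_pos u k) &
      forall p, last_pos u k < p <= k -> u p = 0].
Proof.
elim: k => [|k [h1 h2 h3 h4]] /=; first by split=> // p; lia.
case: ifP => hu; first by split=> //; [lia|move=> p; lia].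
split=> //; first by lia.
move=> p hp; have [->|ne] := eqVneq p k.+1; first by lia.
by apply: h4; lia.
Qed.

Lemma last_pos_eq u k q : 1 <= q <= maxn 1 k -> (1 < q -> 0 < u q) ->
  (forall p, q < p <= k -> u p = 0) -> last_pos u k = q.
Proof.
move=> hq h1 h2; have [g1 g2 g3 g4] := last_posP u k.
case: (ltngtP (last_pos u k) q) => // h.
- have := h1; rewrite g4; lia.
- have := g3; rewrite h2; lia.
Qed.

Lemma free_posP u v k :
  [/\ 1 <= free_pos u v k, free_pos u v k <= maxn 1 k,
      1 < free_pos u v k ->
        excess u v (free_pos u v k).-1 < u (free_pos u v k) &
      forall p, free_pos u v k < p <= k -> u p <= excess u v p.-1].
Proof.
elim: k => [|k [h1 h2 h3 h4]] /=; first by split=> // p; lia.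
case: ifP => hu; first by split=> //; [lia|move=> p; lia].
split=> //; first by lia.
move=> p hp; have [->|ne] := eqVneq p k.+1; first by move=> /=; lia.
by apply: h4; lia.
Qed.

Lemma free_pos_eq u v k q : 1 <= q <= maxn 1 k ->
  (1 < q -> excess u v q.-1 < u q) ->
  (forall p, q < p <= k -> u p <= excess u v p.-1) -> free_pos u v k = q.
Proof.
move=> hq h1 h2; have [g1 g2 g3 g4] := free_posP u v k.
case: (ltngtP (free_pos u v k) q) => // h.
- have := g4 q; lia.
- have := h2 (free_pos u v k); lia.
Qed.

Lemma eq_excess u v u' v' k : (forall p, 1 <= p <= k -> u p = u' p) ->
  (forall p, 1 <= p <= k -> v p = v' p) -> excess u v k = excess u' v' k.
Proof.
elim: k => //= k IH hu hv; rewrite hu ?hv; try lia.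
by rewrite IH // => p hp; [apply: hu|apply: hv]; lia.
Qed.

Lemma eq_free_pos u v u' v' k : (forall p, 1 <= p <= k -> u p = u' p) ->
  (forall p, 1 <= p <= k -> v p = v' p) -> free_pos u v k = free_pos u' v' k.
Proof.
elim: k => //= k IH hu hv; rewrite (@eq_excess u v u' v') ?hu; try lia.
- by rewrite IH // => p hp; [apply: hu|apply: hv]; lia.
- by move=> p hp; apply: hu; lia.
- by move=> p hp; apply: hv; lia.
Qed.

Lemma eq_last_pos u u' k : (forall p, 1 <= p <= k -> u p = u' p) ->
  last_pos u k = last_pos u' k.
Proof.
elim: k => //= k IH hu; rewrite hu; last by lia.
by rewrite IH // => p hp; apply: hu; lia.
Qed.

Lemma leq_last_pos u u' k k' : k <= k' ->
  (forall p, 1 <= p <= k -> 0 < u p -> 0 < u' p) ->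
    last_pos u k <= last_pos u' k'.
Proof.
move=> hk hu; have [g1 g2 g3 g4] := last_posP u k.
have [h1 h2 h3 h4] := last_posP u' k'.
case: leqP => // hlt.
have hp : 0 < u (last_pos u k) by apply: g3; lia.
have := hu (last_pos u k); have := h4 (last_pos u k); lia.
Qed.

(** Where u vanishes nothing is cancelled, so a zero excess at the end forces
    both the excess and v to vanish there. *)
Lemma excess_eq0 u v k p : excess u v k = 0 -> p <= k ->
  (forall q, p < q <= k -> u q = 0) ->
  excess u v p = 0 /\ forall q, p < q <= k -> v q = 0.
Proof.
elim: k => [|k IH] /= h0 hp hu.
  by rewrite leqn0 in hp; rewrite (eqP hp); split=> // q; lia.
have [e|ne] := eqVneq p k.+1; first by split=> [|q]; [rewrite e /=; lia|lia].
have [||q hq|e0 ev] := IH; [|lia|apply: hu; lia|].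
  by have := hu k.+1; lia.
split=> // q hq; have [->|nq] := eqVneq q k.+1; first by lia.
by apply: ev; lia.
Qed.

Lemma excess_v0 u v p k : p <= k -> excess u v p = 0 ->
  (forall q, p < q <= k -> v q = 0) -> excess u v k = 0.
Proof.
move=> hp h0; elim: k hp => [|k IH] hp hv //.
have [eqp|ne] := eqVneq p k.+1; first by rewrite -eqp.
rewrite /= hv ?IH; try lia.
by move=> q hq; apply: hv; lia.
Qed.

(** The data u, v of row j are turned into u', v' by A_k, which raises the
    positions x, y and z in rows j + 1, j and j - 1: it uses up a U at y, adds
    a V at y and a U at x + 1, and removes a V at z - 1.  The choice x = m,
    where m is the length of row j, covers k = j, and x = y = m + 1 covers
    k = j - 1. *)
Section Insertion.
Variables (m x y : nat) (u v u' v' w : nat -> nat).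
Let z := last_pos w y.
Hypotheses (y_gt0 : 0 < y) (hyx : y <= x) (hxm : x <= m.+1).
Hypothesis u0 : forall p, y < p <= x -> u p = 0.
Hypothesis uy : 1 < y <= m -> 0 < u y.
Hypothesis vw : forall p, v p = w p.+1.
Hypothesis u'E : forall p, 1 <= p <= m -> u' p = u p + (p == x.+1) - (p == y).
Hypothesis v'E : forall p, 1 <= p <= m -> v' p = v p + (p == y) - (p.+1 == z).

Local Notation e := (excess u v).
Local Notation e' := (excess u' v').

Let z_le : 1 <= z <= y.
Proof. by have [] := last_posP w y; rewrite -/z; lia. Qed.
Let v0 p : z <= p < y -> v p = 0.
Proof. by have [_ _ _ h] := last_posP w y => hp; rewrite vw h // -/z; lia. Qed.
Let vz : 1 < z -> 0 < v z.-1.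
Proof.
move=> h; have [_ _ h3 _] := last_posP w y.
by rewrite vw prednK; [apply: h3|lia].
Qed.

(** A_k removes the last V before y, if there is one.  Between its position
    z - 1 and y there is no other V, so removing it lowers the excess by one
    until the excess reaches 0.  If z = 1 there is no V before y at all, and
    the excess is 0 on both sides. *)
Lemma excess_below p : p <= m -> p < y ->
  e' p = if p < z.-1 then e p else (e p).-1.
Proof.
elim: p => [|p IH] hm hy /=; first by case: ifP.
rewrite IH ?u'E ?v'E; try lia.
have e1 : (p.+1 == x.+1) = false by lia.
have e2 : (p.+1 == y) = false by lia.
rewrite e1 e2.
case: (ltngtP p.+1 z.-1) => h.
- by lia.
- have -> : (p.+2 == z) = false by lia.
  rewrite (v0 (p := p.+1)); lia.
- have -> : (p.+2 == z) by lia.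
  have := vz; rewrite -h; lia.
Qed.

(** If the excess before y is positive, using up the U at y makes up for the V
    removed earlier; if it is 0, that U cancelled nothing.  In both cases the V
    added at y is one more, and the next U lies beyond x. *)
Lemma excess_between p : p <= m -> y <= p <= x -> e' p = (e p).+1.
Proof.
elim: p => [|p IH] hm hy /=; first by lia.
rewrite u'E ?v'E; try lia.
have e1 : (p.+1 == x.+1) = false by lia.
have e2 : (p.+2 == z) = false by lia.
rewrite e1 e2.
have [h|h] := eqVneq p.+1 y.
- rewrite excess_below; try lia.
  have hp : 1 < y -> 0 < u p.+1 by rewrite h => ?; apply: uy; lia.
  case: ifP => hz; first by lia.
  case: (posnP p) hp => [->|] /=; lia.
- rewrite IH ?(u0 (p := p.+1)); lia.
Qed.

(** The U that A_k adds at x + 1 cancels the surplus V. *)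
Lemma excess_above p : p <= m -> x < p -> e' p = e p.
Proof.
elim: p => [|p IH] hm hy /=; first by lia.
rewrite u'E ?v'E; try lia.
have e1 : (p.+2 == z) = false by lia.
have e2 : (p.+1 == y) = false by lia.
rewrite e1 e2.
have [h|h] := eqVneq p.+1 x.+1.
- rewrite excess_between; lia.
- rewrite IH; lia.
Qed.

Local Notation p0 := (free_pos u v m).
Local Notation p0' := (free_pos u' v' m).
Local Notation uf := (fun p => u p - (p == p0)).
Local Notation wf := (fun p => w p + (p == p0.+1)).

(** No V is left over before y and there is no second U at y, so using up the U
    at y moves the free position to the last U before y.  A chain that finds
    this U missing goes to the same place, and then on to the same z. *)
Lemma free_exhausted : 1 < y <= m.+1 -> e y.-1 = 0 -> (y <= m -> u y = 1) ->
  (forall p, x < p <= m -> u p <= e p.-1) ->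
  p0' = last_pos u y.-1 /\ z = last_pos w (last_pos u y.-1).
Proof.
move=> hy e0 uy1 hx; set t := last_pos u y.-1.
have [t1 t2 t3 t4] := last_posP u y.-1; rewrite -/t in t1 t2 t3 t4.
have [|q|et vt] := excess_eq0 (p := t) e0; first by lia.
  by move=> hq; apply: t4; lia.
have hz : z <= t.
  case: leqP => // hlt; have := vz; have := vt z.-1.
  have [h|h] := eqVneq z.-1 t; last by lia.
  move: et; rewrite -(prednK t1) /= (prednK t1) h; lia.
split.
- apply: free_pos_eq; first by lia.
  + move=> t_gt1; rewrite excess_below ?u'E; try lia.
    have -> : (t.-1 < z.-1) = false by lia.
    have := t3 t_gt1; move: et; rewrite -{1}(prednK t1) /= (prednK t1).
    by lia.
  + move=> p hp; rewrite u'E; last by lia.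
    case: (ltngtP p y) => hpy.
    * rewrite t4; lia.
    * case: (leqP p x) => hpx; first by rewrite u0; lia.
      have [h|h] := eqVneq p x.+1.
        have := hx p; rewrite h /= excess_between; lia.
      have := hx p; rewrite excess_above; lia.
    * subst p; rewrite uy1; lia.
- symmetry; have [h1 h2 h3 h4] := last_posP w y; rewrite -/z in h1 h2 h3 h4.
  apply: last_pos_eq => //; first by lia.
  by move=> p hp; apply: h4; lia.
Qed.

(** If some V is left over before y and the free U lies before y, then it lies
    even before the V that A_k removes: there is no V from z to y - 1, so a
    free U there would bring the excess down to 0. *)
Lemma free_kept : p0 < y -> 0 < e y.-1 -> y <= m.+1 ->
  [/\ p0' = p0, p0 < z & last_pos wf y = z].
Proof.
move=> hp e_gt0 hym.
have [g1 g2 g3 g4] := free_posP u v m.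
have hz : p0 < z.
  case: leqP => // h.
  have : e y.-1 = 0; last by lia.
  apply: (@excess_v0 _ _ p0); first by lia; last first.
  - rewrite -(prednK g1) /= (prednK g1) v0; last by lia.
    have [->|ne] := eqVneq p0 1; first by [].
    have := g3; lia.
  - by move=> q hq; apply: v0; lia.
split => //.
- apply: free_pos_eq; first by lia.
  + move=> h; rewrite u'E ?excess_below; try lia.
    have -> : p0.-1 < z.-1 by lia.
    have := g3; lia.
  + move=> p hpp; rewrite u'E; last by lia.
    have := g4 p hpp.
    case: (ltngtP p y) => hpy hup.
    * rewrite excess_below; try lia.
      case: ifP => hpz; first by lia.
      case: (ltnP (u p) (e p.-1)) => h; first by lia.
      have [h0|h0] := posnP (u p); first by lia.
      have : e y.-1 = 0; last by lia.
      apply: (@excess_v0 _ _ p); first by lia; last first.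
      -- rewrite -(ltn_predK (m := 0) (n := p)) /=; last by lia.
         rewrite prednK ?v0; lia.
      -- by move=> q hq; apply: v0; lia.
    * case: (leqP p x) => hpx; first by rewrite u0; lia.
      have [h|h] := eqVneq p x.+1.
        move: hup; rewrite h /= excess_between; lia.
      rewrite excess_above; lia.
    * rewrite excess_below; try lia.
      case: ifP => hpz; lia.
- have [h1 h2 h3 h4] := last_posP w y; rewrite -/z in h1 h2 h3 h4.
  apply: last_pos_eq; [lia|by move=> h; rewrite addn_gt0 h3|].
  by move=> p hpp; rewrite h4; lia.
Qed.

(** The local form of the commutation of f_j with A_k.  The two orders send the
    chain to the same position z in row j - 1, and in row j they raise
    the same two positions, possibly in the opposite order. *)
Lemma insertion_free_pos : y <= m -> x <= m ->
  last_pos wf (last_pos uf x) = z /\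
  (p0' = p0 /\ last_pos uf x = y \/ p0' = last_pos uf x /\ p0 = y).
Proof.
move=> hym hxm'.
have [g1 g2 g3 g4] := free_posP u v m.
have [h1 h2 h3 h4] := last_posP w y; rewrite -/z in h1 h2 h3 h4.
case: (ltngtP p0 y) => hp.
- have ey : 0 < e y.-1 by have := g4 y; have := uy; lia.
  have [e1 e2 e3] := free_kept hp ey (leqW hym).
  have e4 : last_pos uf x = y.
    apply: last_pos_eq; [lia|have := uy; lia|].
    by move=> p hpp; rewrite u0; lia.
  by rewrite e4; split=> //; left.
- have hx : x < p0.
    by case: leqP => // h; have := u0 (p := p0); have := g3; lia.
  have e4 : last_pos uf x = y.
    apply: last_pos_eq; [lia|have := uy; lia|].
    by move=> p hpp; rewrite u0; lia.
  rewrite e4; split.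
    apply: last_pos_eq; [lia|by move=> h; rewrite addn_gt0 h3|].
    by move=> p hpp; rewrite h4; lia.
  left; split => //; apply: free_pos_eq; first by lia.
  + move=> _; rewrite u'E; last by lia.
    have [h|h] := eqVneq p0 x.+1.
      have := g3; rewrite h /= excess_between; lia.
    have := g3; rewrite excess_above; lia.
  + move=> p hpp; rewrite u'E; last by lia.
    rewrite excess_above; have := g4 p; lia.
- case: (boolP ((1 < y) && (u y == 1) && (e y.-1 == 0))) => hc.
  (* The letter at y is the only free U, and the chain of the modified row has
     to avoid it. *)
  + have [|||p hpp|e1 e2] := free_exhausted; [lia|lia|lia|apply: g4; lia|].
    have e4 : last_pos uf x = last_pos u y.-1.
      have [k1 k2 k3 k4] := last_posP u y.-1.
      apply: last_pos_eq; [lia|lia|move=> p hpp].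
      case: (ltngtP p y) => hpy; [rewrite k4|rewrite u0|subst p]; lia.
    have k := last_posP u y.-1; case: k => k1 k2 k3 k4.
    rewrite e4 e1; split; last by right.
    rewrite e2; apply: eq_last_pos => p hpp.
    have -> : (p == p0.+1) = false by lia.
    by rewrite addn0.
  + have e4 : last_pos uf x = y.
      apply: last_pos_eq; [lia| |by move=> p hpp; rewrite u0; lia].
      by move=> hy; move: g3; rewrite hp; lia.
    rewrite e4; split.
      apply: last_pos_eq; [lia|by move=> h; rewrite addn_gt0 h3|].
      by move=> p hpp; rewrite h4; lia.
    left; split => //; rewrite hp; apply: free_pos_eq; first by lia.
    * move=> hy; rewrite u'E ?excess_below; try lia.
      have -> : (y.-1 < z.-1) = false by lia.
      by move: g3; rewrite hp; lia.
    * move=> p hpp; rewrite u'E; last by lia.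
      case: (leqP p x) => hpx; first by rewrite u0; lia.
      have [h|h] := eqVneq p x.+1.
        have := g4 p; rewrite h /= excess_between; lia.
      have := g4 p; rewrite excess_above; lia.
Qed.

End Insertion.

(** * Entries of triangular arrays and the crystal operators *)

Definition in_tri n i j := [&& 0 < i, 0 < j & i + j <= n.+1].

Lemma entry_mkarray n f i j :
  entry (mkarray n f) i j = if in_tri n i j then f i j else 0.
Proof.
have vi k : val (inord k : 'I_n.+1) = if k < n.+1 then k else 0.
  by rewrite /inord val_insubd.
rewrite /entry /in_tri; case: insubP => [p hp vp|] /=.
- rewrite ffunE vp /=; move: hp; rewrite /= !vi.
  by case: ifP => _; case: ifP => _; rewrite ?andbF // => ->.
- rewrite /= !vi; case: (boolP [&& 0 < i, 0 < j & i + j <= n.+1]) => // h.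
  by case: ifP => hi; case: ifP => hj; rewrite ?h //; lia.
Qed.

Lemma array_ext n (Y Z : array n) :
  (forall i j, in_tri n i j -> entry Y i j = entry Z i j) -> Y = Z.
Proof.
move=> h; apply/ffunP => p; have hp := valP p.
have := h (val p).1 (val p).2; rewrite /in_tri hp => /(_ isT).
rewrite /entry !inord_val.
have -> : ((val p).1, (val p).2) = val p by case: (val p).
by rewrite valK.
Qed.

Lemma mkarray_entry n (Y : array n) : mkarray n (entry Y) = Y.
Proof. by apply: array_ext => i j h; rewrite entry_mkarray h. Qed.

Lemma entry_out n (Y : array n) i j : ~~ in_tri n i j -> entry Y i j = 0.
Proof. by rewrite -(mkarray_entry Y) entry_mkarray => /negbTE->. Qed.

Lemma array_ext_all n (Y Z : array n) :
  (forall i j, entry Y i j = entry Z i j) -> Y = Z.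
Proof. by move=> h; apply: array_ext => i j _. Qed.

Lemma entry_raise n (Y : array n) i j a b : in_tri n i j ->
  entry (raise Y i j) a b = entry Y a b + ((a == i) && (b == j)).
Proof.
move=> hij; rewrite entry_mkarray; case: ifP => [_|/negbT h].
  by case: ifP => _; rewrite ?addn1 ?addn0.
rewrite (entry_out Y h); case: eqP => // ea; case: eqP => // eb.
by rewrite ea eb hij in h.
Qed.

(** The inequalities of [in_P], extended by the zero value of [entry] to all
    rows and to all columns j > 0. *)
Definition mono n (Y : array n) :=
  forall i j, 0 < j -> entry Y i j.+1 <= entry Y i.+1 j.

Lemma in_P_mono n (w : n.-tuple nat) (Y : array n) : in_P w Y -> mono Y.
Proof.
case=> _ h i j hj; have [hi|hi] := posnP i.
  by rewrite entry_out // /in_tri hi.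
case: (leqP (i.+1 + j) n.+1) => hij; first by apply: (h i.+1 j).
by rewrite entry_out // /in_tri; lia.
Qed.

Section FixedSize.
Variable n : nat.
Implicit Types X Y Z : array n.

(** The number of segments [i + 1, i + j - 1] when j > 1: each of them permits a
    raise at (i, j). *)
Definition slack Y i j := entry Y i.+1 j.-1 - entry Y i j.

(** The number of segments [j, j + p - 1].  For j = 1 it is y_1p, since row 0
    is zero. *)
Definition shift_slack Y j p := slack Y j.-1 p.+1.

(** The function eps_j and the operator f_j of the crystal of multisegments of
    type A_n. *)
Definition eps Y j := excess (slack Y j) (shift_slack Y j) (n.+1 - j).
Definition crystal_pos Y j := free_pos (slack Y j) (shift_slack Y j) (n.+1 - j).
Definition crystal j Y := raise Y j (crystal_pos Y j).

Lemma slackK Y i j : mono Y -> 1 < j ->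
  slack Y i j + entry Y i j = entry Y i.+1 j.-1.
Proof.
move=> h hj; have := h i j.-1; rewrite /slack (ltn_predK hj); lia.
Qed.

Lemma slack1 Y i : slack Y i 1 = 0.
Proof. by rewrite /slack /= entry_out // /in_tri; lia. Qed.

Lemma crystal_pos_tri Y j : 0 < j <= n -> in_tri n j (crystal_pos Y j).
Proof.
by move=> hj; have [] := free_posP (slack Y j) (shift_slack Y j) (n.+1 - j);
  rewrite -/(crystal_pos Y j) /in_tri; lia.
Qed.

Lemma entry_crystal Y j a b : 0 < j <= n ->
  entry (crystal j Y) a b = entry Y a b + ((a == j) && (b == crystal_pos Y j)).
Proof. by move=> hj; rewrite entry_raise ?crystal_pos_tri. Qed.

Lemma slack_raise Y i j r p : mono Y -> in_tri n i j -> 0 < p ->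
  slack (raise Y i j) r p =
  slack Y r p + ((r.+1 == i) && (p == j.+1)) - ((r == i) && (p == j)).
Proof.
move=> h hij hp; have [p1|p1] := eqVneq p 1.
  by rewrite p1 !slack1; move: hij; rewrite /in_tri; lia.
have := slackK r (j := p) h; rewrite {2}/slack !entry_raise //.
move: hij; rewrite /in_tri; lia.
Qed.

(** * The operations A_k as chains of raisings *)

(** [chain_pos Y k r] is the column that A_k raises in row r; the auxiliary
    recursion is on k - r.  A raise in row r + 1 changes the slack of row r only
    beyond the bound passed down to row r, so all the columns can be computed
    on the initial array.  Row 0 is allowed: [chain_pos Y k 0 = 1] says that
    row 1 vanishes to the left of the column raised there. *)
Fixpoint chain_rec Y d r :=
  last_pos (slack Y r) (if d is d'.+1 then chain_rec Y d' r.+1 else n.+1 - r).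
Definition chain_pos Y k r := chain_rec Y (k - r) r.

Lemma chain_top Y k : chain_pos Y k k = last_pos (slack Y k) (n.+1 - k).
Proof. by rewrite /chain_pos subnn. Qed.

Lemma chain_step Y k r : r < k ->
  chain_pos Y k r = last_pos (slack Y r) (chain_pos Y k r.+1).
Proof.
move=> h; rewrite /chain_pos; have -> : k - r = (k - r.+1).+1 by lia.
by [].
Qed.

Lemma chain_bounds Y k r : r <= k <= n ->
  [/\ 0 < chain_pos Y k r, chain_pos Y k r <= n.+1 - k &
      r < k -> chain_pos Y k r <= chain_pos Y k r.+1].
Proof.
move=> hk; have [d hd] : {d | k = r + d} by exists (k - r); lia.
elim: d r hk hd => [|d IH] r hk hd.
  have -> : r = k by lia.
  by rewrite chain_top; have [] := last_posP (slack Y k) (n.+1 - k); split; lia.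
have [||h1 h2 h3] := IH r.+1; [lia|lia|].
have [h4 h5 _ _] := last_posP (slack Y r) (chain_pos Y k r.+1).
by rewrite (@chain_step Y k r); [split|]; lia.
Qed.

Lemma chain_slack_gt0 Y k r : r <= k -> 1 < chain_pos Y k r ->
  0 < slack Y r (chain_pos Y k r).
Proof.
rewrite leq_eqVlt => /orP[/eqP<-|h].
  by rewrite chain_top; have [] := last_posP (slack Y r) (n.+1 - r).
by rewrite chain_step //; have [] := last_posP (slack Y r) (chain_pos Y k r.+1).
Qed.

Lemma chain_slack0 Y k r p : r <= k ->
  chain_pos Y k r < p <= (if r < k then chain_pos Y k r.+1 else n.+1 - r) ->
    slack Y r p = 0.
Proof.
rewrite leq_eqVlt => /orP[/eqP<-|h].
  by rewrite ltnn chain_top => hp;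
    have [_ _ _ ->] := last_posP (slack Y r) (n.+1 - r).
by rewrite h chain_step // => hp;
  have [_ _ _ ->] := last_posP (slack Y r) (chain_pos Y k r.+1).
Qed.

Lemma invK_last Y i k : invK Y i k = last_pos (slack Y i) k.
Proof.
rewrite /invK; elim: k => [|k IH]; first by rewrite big_geq.
case: (leqP 2 k.+1) => hk; last first.
  have -> : k = 0 by lia.
  by rewrite big_geq //= slack1.
rewrite big_mkcond big_nat_recr //= -big_mkcond -/(slack Y i k.+1) /=.
rewrite /slack /= subn_gt0; move: IH; rewrite /slack /= => <-;
  case: ifP => hs; last by rewrite maxn0.
have : \max_(2 <= j < k.+1 | entry Y i j < entry Y i.+1 j.-1) j <= k.
  by rewrite big_seq_cond; apply/bigmax_leqP_seq => j; rewrite mem_index_iota;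
    lia.
lia.
Qed.

Lemma entry_proc_A k Y a b : k <= n -> entry (proc_A k Y) a b =
  entry Y a b + ((0 < a <= k) && (b == chain_pos Y k a)).
Proof.
move=> hk; rewrite /proc_A.
suff H d : d <= k ->
    [/\ (iter d (@proc_a n) (Y, k, n.+1 - k)).1.2 = k - d,
     (iter d (@proc_a n) (Y, k, n.+1 - k)).2 =
       (if d is d'.+1 then chain_pos Y k (k - d') else n.+1 - k) &
     forall a b, entry (iter d (@proc_a n) (Y, k, n.+1 - k)).1.1 a b =
       entry Y a b + ((k - d < a <= k) && (b == chain_pos Y k a))].
  by have [_ _ ->] := H k (leqnn k); rewrite subnn.
elim: d => [_|d IH hd].
  by split; rewrite ?subn0 // => i j /=; lia.
have [h1 h2 h3] := IH (ltnW hd).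
rewrite iterS; move: h1 h2 h3; case: (iter d _ _) => [[Z i] q] /= -> -> hZ.
set q' := (X in invK _ _ X).
have e : invK Z (k - d) q' = chain_pos Y k (k - d).
  rewrite invK_last.
  have -> : chain_pos Y k (k - d) = last_pos (slack Y (k - d)) q'.
    rewrite /q'; case: (d) hd => [|d'] hd; first by rewrite subn0 chain_top.
    rewrite chain_step; last by lia.
    by congr (last_pos _ (chain_pos _ _ _)); lia.
  apply: eq_last_pos => p hp; rewrite /slack !hZ.
  have -> : (k - d < (k - d).+1 <= k) && (p.-1 == chain_pos Y k (k - d).+1) =
    false.
    move: hp; rewrite /q'; case: (d) hd => [|d'] hd; first by lia.
    have -> : (k - d'.+1).+1 = k - d' by lia.
    lia.
  lia.
have [|g1 g2 _] := @chain_bounds Y k (k - d); first by lia.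
rewrite e; split => [|//|a' b']; first by lia.
rewrite entry_raise; last by rewrite /in_tri; lia.
rewrite hZ -addnA; congr (_ + _).
have [->|ne] := eqVneq a' (k - d); lia.
Qed.

End FixedSize.

(** * Commutation of the crystal operators with A_k *)

Section FixedSize.
Variable n : nat.
Implicit Types X Y Z : array n.

(** The slack of row r counts segments starting at r + 1: it loses the one that
    A_k extends to r and gains the one that A_k extends to r + 1. *)
Lemma slack_proc_A k Y r p : mono Y -> k <= n -> 0 < p ->
  slack (proc_A k Y) r p =
  slack Y r p + ((r < k) && (p == (chain_pos Y k r.+1).+1))
    - ((0 < r <= k) && (p == chain_pos Y k r)).
Proof.
move=> h hk hp; have [p1|p1] := eqVneq p 1.
  have : r < k -> 0 < chain_pos Y k r.+1.
    by move=> hr; have [] := @chain_bounds n Y k r.+1; lia.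
  by rewrite p1 !slack1; lia.
have := slackK r (j := p) h; rewrite {2}/slack !entry_proc_A //.
lia.
Qed.

Lemma proc_A_mono k Y : mono Y -> k <= n -> mono (proc_A k Y).
Proof.
move=> h hk a b hb; rewrite !entry_proc_A //.
have := h a b hb; case: (boolP ((0 < a <= k) && (b.+1 == chain_pos Y k a))) =>
  hc; last by lia.
have := @chain_slack_gt0 n Y k a; rewrite /slack.
have <- : b.+1 = chain_pos Y k a by lia.
rewrite /=; lia.
Qed.

Lemma chain_congr X Y k r s : r <= s <= k ->
  chain_pos X k s = chain_pos Y k s ->
  (forall i p, r <= i < s -> 1 <= p <= n -> slack X i p = slack Y i p) ->
  k <= n -> 0 < k -> chain_pos X k r = chain_pos Y k r.
Proof.
move=> hr hs hX hk hk0; have [d hd] : {d | s = r + d} by exists (s - r); lia.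
elim: d r hr hd hX => [|d IH] r hr hd hX; first by have -> : r = s by lia.
rewrite (@chain_step n X) 1?(@chain_step n Y); try lia.
rewrite (IH r.+1); try lia; last by move=> i p hi hp; apply: hX; lia.
apply: eq_last_pos => p hp; apply: hX; first lia.
by have [|g1 g2 g3] := @chain_bounds n Y k r.+1; lia.
Qed.

Lemma chain_congr_top X Y k r : r <= k <= n -> 0 < k ->
  (forall i p, r <= i <= k -> 1 <= p <= n -> slack X i p = slack Y i p) ->
  chain_pos X k r = chain_pos Y k r.
Proof.
move=> hr hk hX; apply: (@chain_congr _ _ _ _ k); try lia.
- by rewrite !chain_top; apply: eq_last_pos => p hp; apply: hX; lia.
- by move=> i p hi hp; apply: hX; lia.
Qed.

(** The chain stops in row 1, so for j = 1 it removes no V; the hypothesis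
    [row1] says that there is no V which it would have to remove. *)
Section Commutation.
Variables (Y : array n) (j k : nat).
Hypotheses (hY : mono Y) (hj : 0 < j <= n) (hk : k <= n).
Let m := n.+1 - j.
Let u := slack Y j.
Let v := shift_slack Y j.
Let u' := slack (proc_A k Y) j.
Let v' := shift_slack (proc_A k Y) j.
Let w := slack Y j.-1.
Let x := if j < k then chain_pos Y k j.+1 else m.

Hypothesis row1 : j = 1 -> chain_pos Y k 0 = 1.

Section Above.
Hypothesis hjk : j <= k.
Let y := chain_pos Y k j.

Let y_bounds : 0 < y <= m /\ y <= x <= m.
Proof.
have [|g1 g2 g3] := @chain_bounds n Y k j; first by lia.
rewrite /x /y /m; case: ifP => h; last by lia.
by have [|k1 k2 k3] := @chain_bounds n Y k j.+1; lia.
Qed.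
Let yE : y = last_pos u x.
Proof.
rewrite /x /y; case: ifP => h; first by rewrite chain_step.
have kj : k = j by lia.
by rewrite kj chain_top.
Qed.
Let zE : last_pos w y = chain_pos Y k j.-1.
Proof. by rewrite [RHS]chain_step ?prednK; try lia. Qed.
Let u0 p : y < p <= x -> u p = 0.
Proof. by have [_ _ _ h] := last_posP u x; rewrite -yE in h; apply: h. Qed.
Let uy : 1 < y <= m -> 0 < u y.
Proof.
by have [_ _ h _] := last_posP u x; rewrite -yE in h => ?; apply: h; lia.
Qed.
Let vw p : v p = w p.+1. Proof. by []. Qed.
Let u'E p : 1 <= p <= m -> u' p = u p + (p == x.+1) - (p == y).
Proof.
move=> hp; rewrite /u' slack_proc_A // ?/x -/u; try lia.
by rewrite -/y /x; case: ifP => h /=; lia.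
Qed.
Let v'E p : 1 <= p <= m -> v' p = v p + (p == y) - (p.+1 == last_pos w y).
Proof.
move=> hp; rewrite /v' /v /shift_slack slack_proc_A //.
rewrite zE prednK; try lia; rewrite -/y.
have [j1|j1] := eqVneq j 1; last by lia.
by rewrite j1 /= row1 //; lia.
Qed.

Lemma eps_proc_A_above : eps (proc_A k Y) j = eps Y j + (j == k).
Proof.
rewrite /eps -/u -/v -/u' -/v' -/m.
have [jk|jk] := eqVneq j k.
- have xm : x = m by rewrite /x; case: ifP; lia.
  by rewrite (@excess_between m x y u v u' v' w) ?addn1; try lia.
- have hx : x < m.
    rewrite /x; have -> : j < k by lia.
    by have [|g1 g2 g3] := @chain_bounds n Y k j.+1; rewrite /m; lia.
  by rewrite addn0 (@excess_above m x y u v u' v' w); try lia.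
Qed.

Let slack_crystal r p : 0 < p -> slack (crystal j Y) r p =
  slack Y r p + ((r.+1 == j) && (p == (crystal_pos Y j).+1))
    - ((r == j) && (p == crystal_pos Y j)).
Proof. by move=> hp; rewrite slack_raise // crystal_pos_tri. Qed.

Lemma crystal_proc_A_above : crystal j (proc_A k Y) = proc_A k (crystal j Y).
Proof.
have [/andP[y1 y2] /andP[y3 y4]] := y_bounds.
have [h1 h2] := insertion_free_pos y1 y3 (leqW y4) u0 uy vw u'E v'E y2 y4.
change (free_pos u v m) with (crystal_pos Y j) in h1, h2.
change (free_pos u' v' m) with (crystal_pos (proc_A k Y) j) in h2.
set p0 := crystal_pos Y j in h1 h2 *.
have above r : j < r <= k -> chain_pos (crystal j Y) k r = chain_pos Y k r.
  move=> hr; apply: chain_congr_top; try lia.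
  by move=> i p hi hp; rewrite slack_crystal; lia.
(* Raising (j, p0) affects the chain in row j through the U used up at p0, and
   in row j - 1 through the V added at p0. *)
have at_j : chain_pos (crystal j Y) k j = last_pos (fun p => u p - (p == p0)) x.
  rewrite (_ : chain_pos _ _ _ = last_pos (slack (crystal j Y) j) x);
    last first.
    rewrite /x; case: ifP => h; first by rewrite chain_step ?above //; lia.
    have kj : k = j by lia.
    by rewrite kj chain_top.
  by apply: eq_last_pos => p hp; rewrite slack_crystal -/p0 -/(u p); lia.
have at_j1 : chain_pos (crystal j Y) k j.-1 = chain_pos Y k j.-1.
  rewrite -zE -h1 -at_j chain_step ?prednK; try lia.
  by apply: eq_last_pos => p hp; rewrite slack_crystal -/p0 /w; lia.
have below r : r < j -> chain_pos (crystal j Y) k r = chain_pos Y k r.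
  move=> hr; apply: (@chain_congr _ _ _ _ j.-1) => //; try lia.
  by move=> i p hi hp; rewrite slack_crystal; lia.
apply: array_ext_all => a b;
  rewrite entry_crystal // !entry_proc_A // entry_crystal //.
rewrite -/p0; case: (ltngtP a j) => ha.
- by rewrite below //; lia.
- have [hak|hak] := leqP a k; first by rewrite above //; lia.
  lia.
- subst a; move: h2; rewrite -at_j -/y; lia.
Qed.

End Above.
End Commutation.

Lemma crystal_proc_A_below Y j k : mono Y -> k.+1 < j <= n ->
  crystal j (proc_A k Y) = proc_A k (crystal j Y) /\
    eps (proc_A k Y) j = eps Y j.
Proof.
move=> hY hj.
have eu p : 1 <= p <= n.+1 - j -> slack (proc_A k Y) j p = slack Y j p.
  by move=> hp; rewrite slack_proc_A //; lia.
have ev p : 1 <= p <= n.+1 - j ->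
  shift_slack (proc_A k Y) j p = shift_slack Y j p.
  by move=> hp; rewrite /shift_slack slack_proc_A //; lia.
split; last by apply: eq_excess.
have e : crystal_pos (proc_A k Y) j = crystal_pos Y j by apply: eq_free_pos.
have ek r : 0 < r <= k -> chain_pos (crystal j Y) k r = chain_pos Y k r.
  move=> hr; apply: chain_congr_top; try lia.
  by move=> i p hi hp; rewrite slack_raise // ?crystal_pos_tri; lia.
apply: array_ext_all => a b.
rewrite entry_crystal ?entry_proc_A ?entry_crystal ?e; try lia.
case: (boolP (0 < a <= k)) => ha; last by lia.
rewrite ek //; lia.
Qed.

(** For k = j - 1 the chain starts in row j - 1 and removes the last V of row j.
    This is the case y = m + 1 of the statements on sequences. *)
Section Adjacent.
Variables (Y : array n) (k : nat).
Hypotheses (hY : mono Y) (hk : 0 < k < n).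
Let j := k.+1.
Let m := n.+1 - j.
Let u := slack Y j.
Let v := shift_slack Y j.
Let u' := slack (proc_A k Y) j.
Let v' := shift_slack (proc_A k Y) j.
Let w := slack Y k.

Let zE : last_pos w m.+1 = chain_pos Y k k.
Proof. by rewrite chain_top /m /j; congr last_pos; lia. Qed.
Let u0 p : m.+1 < p <= m.+1 -> u p = 0. Proof. lia. Qed.
Let uy : 1 < m.+1 <= m -> 0 < u m.+1. Proof. lia. Qed.
Let vw p : v p = w p.+1. Proof. by []. Qed.
Let u'E p : 1 <= p <= m -> u' p = u p + (p == m.+2) - (p == m.+1).
Proof. by move=> hp; rewrite /u' slack_proc_A // -/u /j; lia. Qed.
Let v'E p : 1 <= p <= m -> v' p = v p + (p == m.+1) - (p.+1 == last_pos w m.+1).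
Proof.
move=> hp; rewrite /v' /v /shift_slack slack_proc_A //; last by lia.
by rewrite zE /j /=; lia.
Qed.

Lemma eps_proc_A_adjacent : eps (proc_A k Y) k.+1 = (eps Y k.+1).-1.
Proof.
rewrite /eps -/j -/u -/v -/u' -/v' -/m.
rewrite (@excess_below m m.+1 m.+1 u v u' v' w) //.
have := last_posP w m.+1; case=> _ h _ _.
by have -> : (m < (last_pos w m.+1).-1) = false by lia.
Qed.

Lemma crystal_proc_A_exhausted : eps Y k.+1 = 0 ->
  crystal k.+1 (proc_A k Y) = proc_A k.+1 Y.
Proof.
rewrite /eps -/j -/u -/v -/m => e0.
have m1 : 1 < m.+1 <= m.+1 by rewrite /m /j; lia.
have um : m.+1 <= m -> u m.+1 = 1 by rewrite ltnn.
have ux p : m.+1 < p <= m -> u p <= excess u v p.-1 by lia.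
have [h1 h2] := free_exhausted (ltn0Sn m) (leqnn _) (leqnn _) u0 uy vw u'E v'E
  m1 e0 um ux.
have e1 : last_pos u m = chain_pos Y k.+1 k.+1 by rewrite chain_top.
have e2 : chain_pos Y k k = chain_pos Y k.+1 k.
  by rewrite [RHS]chain_step // -e1 -zE h2.
have below r : r <= k -> chain_pos Y k r = chain_pos Y k.+1 r.
  move=> hr; have [d hd] : {d | k = r + d} by exists (k - r); lia.
  elim: d r hr hd => [|d IH] r hr hd; first by have -> : r = k by lia.
  by rewrite !(@chain_step n _ _ r) ?IH; try lia.
apply: array_ext_all => a b.
rewrite entry_crystal ?entry_proc_A; try lia.
have -> : crystal_pos (proc_A k Y) k.+1 = chain_pos Y k.+1 k.+1
  by rewrite -e1 -h1.
case: (ltngtP a k.+1) => ha.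
- rewrite below // /j; lia.
- lia.
- rewrite ha /j; lia.
Qed.

Lemma crystal_proc_A_adjacent : 0 < eps Y k.+1 ->
  crystal k.+1 (proc_A k Y) = proc_A k (crystal k.+1 Y).
Proof.
rewrite /eps -/j -/u -/v -/m => e0.
have p_le : free_pos u v m < m.+1.
  by have [] := free_posP u v m; rewrite /m /j; lia.
have [h1 h2 h3] :=
  free_kept (ltn0Sn m) (leqnn _) (leqnn _) u0 uy vw u'E v'E p_le e0 (leqnn _).
change (free_pos u v m) with (crystal_pos Y j) in h1, h2, h3.
change (free_pos u' v' m) with (crystal_pos (proc_A k Y) j) in h1.
have slack_crystal r p : 0 < p -> slack (crystal j Y) r p =
  slack Y r p + ((r.+1 == j) && (p == (crystal_pos Y j).+1))
    - ((r == j) && (p == crystal_pos Y j)).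
  by move=> hp; rewrite slack_raise // crystal_pos_tri /j //; lia.
have at_k : chain_pos (crystal j Y) k k = chain_pos Y k k.
  rewrite -zE -h3 chain_top (_ : n.+1 - k = m.+1); last by rewrite /m /j; lia.
  by apply: eq_last_pos => p hp; rewrite slack_crystal /w /j; lia.
have below r : r <= k -> chain_pos (crystal j Y) k r = chain_pos Y k r.
  move=> hr; apply: (@chain_congr _ _ _ _ k) => //; try lia.
  by move=> i p hi hp; rewrite slack_crystal /j; lia.
apply: array_ext_all => a b.
rewrite entry_crystal ?entry_proc_A ?entry_crystal -/j ?h1; rewrite /j; try lia.
case: (leqP a k) => ha; last by lia.
rewrite below //; lia.
Qed.

End Adjacent.

End FixedSize.

(** * Nondecreasing sequences of operations A_k *)

Section Stages.
Variable n : nat.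
Implicit Types (X Y Z : array n) (c : nat -> nat).

(** The condition under which the operations A_{k'} with k' >= k can be undone
    by B and commute with f_1. *)
Definition row1_free k X := forall k', k <= k' -> 0 < k' <= n ->
  chain_pos X k' 0 = 1.

(** The analogue of the row bumping lemma.  The later chain has a smaller bound
    in each row, by induction from row k down, and below that bound the slack
    has not increased. *)
Lemma chain_proc_A_leq X k k' r : mono X -> 0 < r <= k -> k <= k' <= n ->
  chain_pos (proc_A k X) k' r <= chain_pos X k r.
Proof.
move=> hX hr hk; have [d hd] : {d | k = r + d} by exists (k - r); lia.
have [b1 b2 b3] : [/\ 0 < chain_pos X k r, chain_pos X k r <= n.+1 - k &
  r < k -> chain_pos X k r <= chain_pos X k r.+1] by apply: chain_bounds; lia.
elim: d r hr hd b1 b2 b3 => [|d IH] r hr hd b1 b2 b3.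
  have rk : r = k by lia.
  subst r; rewrite chain_top.
  have [kk'|kk'] := eqVneq k k'.
    subst k'; rewrite chain_top; apply: leq_last_pos => // p hp.
    by rewrite slack_proc_A //; lia.
  rewrite chain_step; last by lia.
  have [|g1 g2 g3] := @chain_bounds n (proc_A k X) k' k.+1; first by lia.
  apply: leq_last_pos => [|p hp]; first by lia.
  by rewrite slack_proc_A //; lia.
have [|c1 c2 c3] := @chain_bounds n X k r.+1; first by lia.
have h := IH r.+1; rewrite (@chain_step n _ k' r) ?(@chain_step n _ k r);
  try lia.
apply: leq_last_pos => [|p hp]; first by apply: h; lia.
by rewrite slack_proc_A //; have := h; lia.
Qed.

Lemma row1_free_proc_A X k : mono X -> 0 < k <= n -> row1_free k X ->
  row1_free k (proc_A k X).
Proof.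
move=> hX hk hfree k' hk' hn.
have hle : chain_pos (proc_A k X) k' 1 <= chain_pos X k 1
  by apply: chain_proc_A_leq => //; lia.
rewrite chain_step; last by lia.
apply: last_pos_eq => [|//|p hp]; first by lia.
rewrite slack_proc_A //; try lia.
have -> : slack X 0 p = 0; last by lia.
have k_gt0 : 0 < k by lia.
by apply: (@chain_slack0 n X k) => //; rewrite k_gt0 hfree //; lia.
Qed.

Lemma row1_free_zero Z : (forall p, entry Z 1 p = 0) -> row1_free 0 Z.
Proof.
move=> hZ k _ hk; rewrite chain_step; last by lia.
have [|g1 g2 g3] := @chain_bounds n Z k 1; first by lia.
by apply: last_pos_eq => // [|p hp]; [lia|rewrite /slack hZ].
Qed.

Lemma iter_proc_A_inv X k t : mono X -> 0 < k <= n -> row1_free k X ->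
  mono (iter t (proc_A k) X) /\ row1_free k (iter t (proc_A k) X).
Proof.
move=> hX hk hfree; elim: t => [|t [IH1 IH2]] //=.
by split; [apply: proc_A_mono => //; lia|apply: row1_free_proc_A].
Qed.

Lemma crystal_iter_above X j k t : mono X -> 0 < j <= k -> k <= n ->
  row1_free k X ->
  crystal j (iter t (proc_A k) X) = iter t (proc_A k) (crystal j X) /\
  eps (iter t (proc_A k) X) j = eps X j + t * (j == k).
Proof.
move=> hX hj hk hfree; elim: t => [|t [IH1 IH2]] /=; first by rewrite addn0.
have [|h1 h2] := @iter_proc_A_inv X k t hX _ hfree; first by lia.
have row1 : j = 1 -> chain_pos (iter t (proc_A k) X) k 0 = 1.
  by move=> _; apply: h2; lia.
have hjn : 0 < j <= n by lia.
have hjk : j <= k by lia.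
rewrite (crystal_proc_A_above h1 hjn hk row1 hjk).
rewrite (eps_proc_A_above h1 hjn hk row1 hjk).
by rewrite IH1 IH2 mulSn; split => //; lia.
Qed.

Lemma crystal_iter_below X j k t : mono X -> k.+1 < j <= n ->
  crystal j (iter t (proc_A k) X) = iter t (proc_A k) (crystal j X) /\
  eps (iter t (proc_A k) X) j = eps X j.
Proof.
move=> hX hj.
have hm s : mono (iter s (proc_A k) X).
  by elim: s => //= s IH; apply: proc_A_mono => //; lia.
elim: t => [|t [IH1 IH2]] //=.
have [-> ->] := @crystal_proc_A_below n (iter t (proc_A k) X) j k (hm t) hj.
by rewrite IH1 IH2.
Qed.

(** The tensor product rule: f_{k+1} passes through up to eps_{k+1} copies of
    A_k; if there are more, they use up eps_{k+1}, and f_{k+1} turns the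
    last of them into A_{k+1}. *)
Lemma crystal_iter_adjacent X k t : mono X -> 0 < k < n ->
  crystal k.+1 (iter t (proc_A k) X) =
    (if t <= eps X k.+1 then iter t (proc_A k) (crystal k.+1 X)
     else proc_A k.+1 (iter t.-1 (proc_A k) X)) /\
  eps (iter t (proc_A k) X) k.+1 = eps X k.+1 - t.
Proof.
move=> hX hk.
have hm s : mono (iter s (proc_A k) X).
  by elim: s => //= s IH; apply: proc_A_mono => //; lia.
elim: t => [|t [IH1 IH2]]; first by rewrite subn0.
rewrite [iter t.+1 _ _]iterS (eps_proc_A_adjacent (hm t) hk) IH2; split;
  last by lia.
case: (ltnP t (eps X k.+1)) => ht.
- rewrite crystal_proc_A_adjacent ?IH2 //; last by lia.
  by rewrite IH1 (ltnW ht).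
- by rewrite crystal_proc_A_exhausted ?IH2 //; lia.
Qed.

Fixpoint stage c Z k :=
  if k is k'.+1 then iter (c k) (proc_A k) (stage c Z k') else Z.

Lemma eq_stage c c' Z k : (forall i, 0 < i <= k -> c i = c' i) ->
  stage c Z k = stage c' Z k.
Proof.
elim: k => //= k IH h; rewrite h ?IH //; last by lia.
by move=> i hi; apply: h; lia.
Qed.

Section Commute.
Variables (c : nat -> nat) (Z : array n).
Hypotheses (hZ : mono Z) (hZ1 : forall p, entry Z 1 p = 0).

Lemma stage_inv k : k <= n -> mono (stage c Z k) /\ row1_free k (stage c Z k).
Proof.
elim: k => [_|k IH hk] /=; first by split=> //; apply: row1_free_zero.
have [h1 h2] := IH (ltnW hk); apply: iter_proc_A_inv => //.
by move=> k' hk'; apply: h2; lia.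
Qed.

Lemma crystal_stage_above j c' Z' k : 0 < j <= k -> k <= n ->
  (forall i, j < i -> c' i = c i) ->
  crystal j (stage c Z j) = stage c' Z' j ->
  crystal j (stage c Z k) = stage c' Z' k /\
  eps (stage c Z k) j = eps (stage c Z j) j.
Proof.
move=> hj hk hc h; elim: k hj hk => [|k IH] hj hk; first by lia.
have [<-|ne] := eqVneq j k.+1; first by [].
have [|h1 h2] := @stage_inv k; first by lia.
have hfree : row1_free k.+1 (stage c Z k) by move=> k' hk'; apply: h2; lia.
have [|e1 e2] := @crystal_iter_above _ j k.+1 (c k.+1) h1 _ hk hfree;
  first by lia.
have [||i1 i2] := IH; [lia|lia|].
by rewrite /= e1 e2 i1 i2 hc; [split => //|]; lia.
Qed.

Lemma crystal_stage_below j k : k.+1 < j <= n ->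
  crystal j (stage c Z k) = stage c (crystal j Z) k /\
    eps (stage c Z k) j = eps Z j.
Proof.
elim: k => [//|k IH] hj /=.
have [|h1 h2] := @stage_inv k; first by lia.
have [|e1 e2] := @crystal_iter_below (stage c Z k) j k.+1 (c k.+1) h1;
  first by lia.
by have [|i1 i2] := IH; [lia|rewrite e1 e2 i1 i2].
Qed.

Lemma eps_zero_row1 : eps Z 1 = 0.
Proof.
rewrite /eps; elim: (n.+1 - 1) => //= k ->.
by rewrite /shift_slack /slack /= hZ1.
Qed.

Lemma crystal_zero_row1 : 0 < n -> crystal 1 Z = proc_A 1 Z.
Proof.
move=> hn.
have e : crystal_pos Z 1 = chain_pos Z 1 1.
  rewrite chain_top /crystal_pos.
  have e0 k : excess (slack Z 1) (shift_slack Z 1) k = 0.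
    by elim: k => //= k ->; rewrite /shift_slack /slack /= hZ1.
  by elim: (n.+1 - 1) => //= k ->; rewrite e0.
apply: array_ext_all => a b; rewrite entry_crystal ?entry_proc_A // e.
have [->|ne] := eqVneq a 1; lia.
Qed.

(** The operator f_j passes the A_k with k < j - 1 freely, at A_{j-1} it passes
    or is absorbed according to eps_j, and it passes the A_k with k >= j.  For
    j = 1 it is always absorbed, because f_1 and A_1 agree on an array with
    zero first row. *)
Lemma crystal_stage j : 0 < j <= n ->
  crystal j (stage c Z n) =
    (if (1 < j) && (c j.-1 <= eps Z j) then stage c (crystal j Z) n
     else stage (fun i => c i + (i == j) - (i == j.-1)) Z n) /\
  eps (stage c Z n) j = (if 1 < j then eps Z j - c j.-1 else 0) + c j.
Proof.
move=> hj; set c' := fun i => _.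
have [j1|j_gt1] : j = 1 \/ 1 < j by lia.
- subst j; rewrite ltnn /=.
  have hfree : row1_free 1 Z by move=> k' hk'; apply: row1_free_zero => //; lia.
  have n_gt0 : 0 < n by lia.
  have [e1 e2] := @crystal_iter_above Z 1 1 (c 1) hZ isT n_gt0 hfree.
  have hc i : 1 < i -> c' i = c i by rewrite /c'; lia.
  have h1 : crystal 1 (stage c Z 1) = stage c' Z 1.
    by rewrite /= e1 crystal_zero_row1 // -iterSr /c' /= addn1 subn0.
  have [a1 a2] := @crystal_stage_above 1 c' Z n hj (leqnn n) hc h1.
  by rewrite a1 a2 /= e2 eps_zero_row1 muln1.
- case: j hj j_gt1 @c' => // -[//|k] hj _; set j := k.+2 => c'.
  have -> : 1 < j by []; rewrite [j.-1]/= andTb.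
  have [|s1 s2] := @stage_inv k; first by lia.
  have [|b1 b2] := @crystal_stage_below j k; first by rewrite /j; lia.
  have [|d1 d2] := @crystal_iter_adjacent (stage c Z k) k.+1 (c k.+1) s1;
    first by lia.
  have [|t1 t2] := @stage_inv k.+1; first by lia.
  have hfree : row1_free j (stage c Z k.+1).
    by move=> k' hk'; apply: t2; rewrite /j in hk'; lia.
  have jk : 0 < j <= n by [].
  have jn : j <= n by [].
  have [e1 e2] := @crystal_iter_above _ j j (c j) t1 (leqnn _) jn hfree.
  have key : crystal j (stage c Z j) =
      (if c k.+1 <= eps Z j then stage c (crystal j Z) j else stage c' Z j).
    rewrite -/j in b1 b2 d1 d2 e1 e2 *.
    rewrite [stage c Z j]/= e1 /= d1 b2 b1.
    case: ifP => hc //=.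
    rewrite -iterSr /c' eqxx /=.
    have -> : c j + 1 - (j == k.+1) = (c j).+1 by rewrite /j; lia.
    have -> : c k.+1 + (k.+1 == j) - (k.+1 == k.+1) = (c k.+1).-1
      by rewrite /j; lia.
    rewrite (@eq_stage c' c) // => i hi; rewrite /c' /j; lia.
  have hc' i : j < i -> c' i = c i by rewrite /c' /j; lia.
  have eE : eps (stage c Z j) j = eps Z j - c k.+1 + c j.
    by rewrite [stage c Z j]/= e2 eqxx muln1 /= d2 b2.
  case: ifP key => hc key.
  + by have [//|-> ->] :=
    @crystal_stage_above j c (crystal j Z) n jk (leqnn n) _ key.
  + by have [-> ->] := @crystal_stage_above j c' Z n jk (leqnn n) hc' key.
Qed.

End Commute.
End Stages.

(** * The Fourier transform intertwines the crystal operators *)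

Lemma foldl_stage n c (Z : array n) k :
  foldl (fun X i => iter (c i) (proc_A i) X) Z (index_iota 1 k.+1) =
  stage c Z k.
Proof.
elim: k => // k IH; rewrite [RHS]/= -IH.
have -> : index_iota 1 k.+2 = rcons (index_iota 1 k.+1) k.+1.
  by rewrite /index_iota !subSS !subn0 -cats1 -(addn1 k) iotaD addn1 add1n.
by rewrite foldl_rcons.
Qed.

Definition pad n (Y : array n) : array n.+1 := cup_top Y (fun _ => 0).

Lemma entry_pad n (Y : array n) a b :
  entry (pad Y) a b = if 1 < a then entry Y a.-1 b else 0.
Proof.
rewrite entry_mkarray; case: ifP => h; last first.
  by case: ifP => // ha; rewrite entry_out // /in_tri; move: h;
    rewrite /in_tri; lia.
by case: eqP => [->//|ne]; have -> : 1 < a by move: h; rewrite /in_tri; lia.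
Qed.

Lemma pad_mono n (Y : array n) : mono Y -> mono (pad Y).
Proof.
move=> h [|[|a]] b hb; rewrite !entry_pad //=.
exact: h.
Qed.

Lemma slack_pad n (Y : array n) r p : slack (pad Y) r.+1 p = slack Y r p.
Proof.
rewrite /slack !entry_pad /=; case: r => [|r] //=.
by rewrite subn0 [entry Y 0 p]entry_out ?subn0 //.
Qed.

Lemma eps_pad n (Y : array n) j : 0 < j -> eps (pad Y) j.+1 = eps Y j.
Proof.
move=> hj; rewrite /eps subSS; apply: eq_excess => p _; rewrite ?slack_pad //.
by rewrite /shift_slack /= -{1}(prednK hj) slack_pad.
Qed.

Lemma crystal_pad n (Y : array n) j : 0 < j <= n ->
  crystal j.+1 (pad Y) = pad (crystal j Y).
Proof.
move=> hj; have j_gt0 : 0 < j by lia.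
have e : crystal_pos (pad Y) j.+1 = crystal_pos Y j.
  rewrite /crystal_pos subSS; apply: eq_free_pos => p _; rewrite ?slack_pad //.
  by rewrite /shift_slack /= -{1}(prednK j_gt0) slack_pad.
apply: array_ext_all => a b;
  rewrite entry_crystal ?entry_pad ?entry_crystal ?e; try lia.
by case: (ltnP 1 a) => ha; lia.
Qed.

Lemma entry_del_ladder n (Y : array n.+1) a b :
  entry (del_ladder Y) a b = if a + b <= n.+1 then entry Y a b else 0.
Proof.
rewrite entry_mkarray; case: ifP; rewrite /in_tri => h;
  first by case: ifP => //; lia.
by case: ifP => // hab; rewrite entry_out // /in_tri; lia.
Qed.

Lemma del_ladder_mono n (Y : array n.+1) : mono Y -> mono (del_ladder Y).
Proof.
move=> h a b hb; rewrite !entry_del_ladder addnS addSn.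
by case: ifP => // _; apply: h.
Qed.

Lemma slack_del_ladder n (Y : array n.+1) r p : 0 < p -> r + p <= n.+1 ->
  slack (del_ladder Y) r p = slack Y r p.
Proof.
move=> hp hr; rewrite /slack !entry_del_ladder hr.
by have -> : r.+1 + p.-1 <= n.+1 by lia.
Qed.

Lemma A_exponentE n (Y : array n) i : 0 < i <= n ->
  A_exponent Y i = slack Y (n - i) i.+1.
Proof.
move=> hi; rewrite /A_exponent /slack /=;
  have -> : (n - i).+1 = n.+1 - i by lia.
case: eqP => [->|//]; rewrite subnn [entry Y 0 _]entry_out // subn0.
by have -> : n.+1 - n = 1 by lia.
Qed.

(** The segments of the last ladder are the longest ones, so they contribute the
    last letters of the bracketing word. *)
Lemma eps_ladder n (Y : array n.+1) i : 0 < i <= n ->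
  eps Y i =
  eps (del_ladder Y) i - slack Y i (n.+2 - i) + slack Y i.-1 (n.+3 - i).
Proof.
move=> hi; rewrite /eps.
have -> : n.+2 - i = (n.+1 - i).+1 by lia.
have -> : n.+3 - i = (n.+1 - i).+2 by lia.
rewrite /= -/(shift_slack Y i _); congr (_ - _ + _).
by apply: eq_excess => p hp; rewrite /shift_slack slack_del_ladder //; lia.
Qed.

Lemma crystal_pos_ladder n (Y : array n.+1) i : 0 < i <= n ->
  crystal_pos Y i =
  if eps (del_ladder Y) i < slack Y i (n.+2 - i) then n.+2 - i
  else crystal_pos (del_ladder Y) i.
Proof.
move=> hi; rewrite /crystal_pos /eps.
have -> : n.+2 - i = (n.+1 - i).+1 by lia.
rewrite /=; congr (if _ < _ then _ else _).
  by apply: eq_excess => p hp; rewrite /shift_slack slack_del_ladder //; lia.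
by apply: eq_free_pos => p hp; rewrite /shift_slack slack_del_ladder //; lia.
Qed.

(** For size 1 the formula also returns Y: starting from 0, it applies A_1,
    which raises the only entry, y_11 times. *)
Lemma fourierE n (Y : array n.+1) :
  fourier Y = stage (A_exponent Y) (pad (fourier (del_ladder Y))) n.+1.
Proof.
case: n Y => [|n] Y; last by rewrite -foldl_stage.
rewrite /= /A_exponent /=; apply: array_ext => a b hab.
have [-> ->] : a = 1 /\ b = 1 by move: hab; rewrite /in_tri; lia.
elim: (entry Y 1 1) => [|t IH] /=; first by rewrite entry_pad.
rewrite entry_proc_A // -{}IH.
have [//|h1 h2 _] :=
  @chain_bounds 1 (iter t (proc_A 1) (pad (mkarray 0 (entry Y)))) 1 1.
rewrite -/(del_ladder Y) in h1 h2 *; lia.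
Qed.

(** The induction carries eps along, because the rule of [crystal_stage] for
    T Y is phrased with eps_j of the padded transform, and that of
    [crystal_pos_ladder] for Y with eps_i of the array without its ladder. *)
Lemma fourier_crystal n (Y : array n) : mono Y ->
  mono (fourier Y) /\ forall i, 0 < i <= n ->
    fourier (crystal i Y) = crystal (n.+1 - i) (fourier Y) /\
    eps (fourier Y) (n.+1 - i) = eps Y i.
Proof.
elim: n Y => [|n IH] Y hY; first by split=> // i; lia.
have [T_mono T_crystal] := IH _ (del_ladder_mono hY).
set Y0 := del_ladder Y in T_mono T_crystal.
set Z := pad (fourier Y0).
have hZ : mono Z by apply: pad_mono.
have hZ1 p : entry Z 1 p = 0 by rewrite entry_pad.
rewrite fourierE -/Y0 -/Z; split;
  first by have [] := stage_inv (A_exponent Y) hZ hZ1 (leqnn _).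
move=> i hi; rewrite fourierE.
set j := n.+2 - i; set c := A_exponent Y.
have hj : 0 < j <= n.+1 by rewrite /j; lia.
have [-> ->] := crystal_stage c hZ hZ1 hj.
have cE k : 0 < k <= n.+1 ->
  c k = slack Y (n.+1 - k) k.+1 by apply: A_exponentE.
have cj : c j = slack Y i.-1 j.+1.
  by rewrite cE //; congr slack; rewrite /j; lia.
have c'E k : 0 < k <= n.+1 -> A_exponent (crystal i Y) k =
    c k + ((n.+2 - k == i) && (k == crystal_pos Y i))
      - ((n.+1 - k == i) && (k.+1 == crystal_pos Y i)).
  move=> hk; rewrite A_exponentE // slack_raise ?crystal_pos_tri // cE // eqSS.
  by have -> : (n.+1 - k).+1 = n.+2 - k by lia.
have del_crystal a b : entry (del_ladder (crystal i Y)) a b = entry Y0 a b +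
    [&& a == i, b == crystal_pos Y i & i + crystal_pos Y i <= n.+1].
  rewrite !entry_del_ladder entry_crystal //.
  by case: ifP; lia.
have [i_le|i_eq] : i <= n \/ i = n.+1 by lia.
- have j_gt1 : 1 < j by rewrite /j; lia.
  have hin : 0 < i <= n by lia.
  have [t1 t2] := T_crystal i hin.
  have jS : j = (n.+1 - i).+1 by rewrite /j; lia.
  have epsZ : eps Z j = eps Y0 i by rewrite jS eps_pad ?t2 //; lia.
  have cj1 : c j.-1 = slack Y i j.
    by rewrite cE; [congr slack|]; rewrite /j; lia.
  have fposE := crystal_pos_ladder Y hin; rewrite -/j -/Y0 -cj1 in fposE.
  rewrite j_gt1 /= epsZ; split; last first.
    by rewrite eps_ladder // -/j -/Y0 cj1 cj; congr (_ + slack Y _ _);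
      rewrite /j; lia.
  case: leqP fposE => h fE.
  (* f_i acts on a segment that ends before n. *)
  + have ladder_free : i + crystal_pos Y i <= n.+1.
      by move: (crystal_pos_tri Y0 hin); rewrite -fE /in_tri; lia.
    have -> : del_ladder (crystal i Y) = crystal i Y0.
      by apply: array_ext_all => a b;
        rewrite del_crystal entry_crystal // -fE; lia.
    rewrite t1 -crystal_pad -?jS; last by lia.
    by apply: (@eq_stage _ _ _ _ n.+1) => k hk; rewrite c'E //; lia.
  + have -> : del_ladder (crystal i Y) = Y0.
      by apply: array_ext_all => a b; rewrite del_crystal fE /j; lia.
    by apply: (@eq_stage _ _ _ _ n.+1) => k hk; rewrite c'E // fE /j; lia.
(* f_n creates the segment [n, n] of the last ladder. *)
- have j1 : j = 1 by rewrite /j; lia.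
  have f1 : crystal_pos Y i = 1.
    by move: (crystal_pos_tri Y hi); rewrite /in_tri; lia.
  rewrite j1 /=; split; last first.
    rewrite /eps (_ : n.+2 - i = 1) /=; last by lia.
    by rewrite sub0n -j1 cj j1.
  have -> : del_ladder (crystal i Y) = Y0.
    by apply: array_ext_all => a b; rewrite del_crystal f1; lia.
  by apply: (@eq_stage _ _ _ _ n.+1) => k hk; rewrite c'E // f1; lia.
Qed.

(** * The Fourier transform is an involution *)

(** A positive entry y_ab counts some segment; its start is found by going down
    along the ladder. *)
Lemma slack_exists n (Y : array n) a b : mono Y -> 0 < entry Y a b ->
  exists i p, [/\ 0 < i, 0 < p & 0 < slack Y i.-1 p.+1].
Proof.
move=> hY; elim: a b => [|a IH] b hab; first by rewrite entry_out in hab.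
have hb : 0 < b.
  by case: b hab => // hab; rewrite entry_out // /in_tri andbF in hab.
have [h0|h0] := posnP (slack Y a b.+1); last by exists a.+1, b.
by apply: (IH b.+1); move: h0; rewrite /slack /=; lia.
Qed.

(** Take the largest start i of a segment and the shortest segment starting
    there, and remove its first element.  No other segment starts at i + 1, and
    no shorter one starts at i, so the shortened segment is free in the
    bracketing word and f_i restores it. *)
Lemma crystal_surj n (Y : array n) a b : mono Y -> 0 < entry Y a b ->
  exists i Y', [/\ 0 < i <= n, mono Y' & Y = crystal i Y'].
Proof.
move=> hY hab.
have tri i p : 0 < i -> 0 < slack Y i.-1 p.+1 -> in_tri n i p.
  move=> hi; rewrite /slack prednK //= => h.
  by apply: contraTT h => h; rewrite (entry_out Y h).
pose P i := (0 < i) && [exists p : 'I_n.+1, 0 < slack Y i.-1 p.+1].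
have exP : exists i, P i.
  have [i [p [hi hp h]]] := slack_exists hY hab.
  exists i; rewrite /P hi; apply/existsP.
  have hpn : p < n.+1 by have := tri _ _ hi h; rewrite /in_tri; lia.
  by exists (Ordinal hpn).
have bdP i : P i -> i <= n.
  by case/andP=> hi /existsP[p /(tri _ _ hi)]; rewrite /in_tri; lia.
case: (ex_maxnP exP bdP) => i /andP[hi exi] maxi.
have exQ : exists p, 0 < slack Y i.-1 p.+1.
  by case/existsP: exi => p hp; exists p.
case: (ex_minnP exQ) => p hp minp.
have tri_ip := tri _ _ hi hp.
have hin : 0 < i <= n by move: tri_ip; rewrite /in_tri; lia.
have entry_Y' c d :
    entry (lower Y i p) c d = entry Y c d - ((c == i) && (d == p)).
  rewrite entry_mkarray; case: ifP => [_|/negbT h];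
    last by rewrite (entry_out Y h).
  by case: ifP => _; lia.
have hY' : mono (lower Y i p).
  move=> c d hd; rewrite !entry_Y'; have := hY c d hd.
  case: (boolP ((c.+1 == i) && (d == p))) => hc; last by lia.
  have [ec ed] : c = i.-1 /\ d = p by lia.
  by move: hp; rewrite /slack -ec -ed /=; lia.
(* No segment starts at i + 1, by the choice of i. *)
have u0 q : 0 < q -> slack Y i q = 0.
  case: q => // q _; case: (posnP (slack Y i q.+1)) => // h.
  have := tri i.+1 q isT h; rewrite /in_tri => hq.
  have hqn : q < n.+1 by lia.
  have : P i.+1 by rewrite /P /=; apply/existsP; exists (Ordinal hqn).
  by move/maxi; lia.
(* No segment starting at i is shorter, by the choice of p. *)
have v0 q : q < p -> slack Y i.-1 q.+1 = 0.
  by move=> hq; case: (posnP (slack Y i.-1 q.+1)) => // h; have := minp _ h;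
    lia.
have Y'E : crystal_pos (lower Y i p) i = p.
  have u'E q : 1 < q -> slack (lower Y i p) i q = (q == p).
    move=> hq; have := u0 q; have := slackK i hY hq; move: tri_ip hp.
    rewrite /in_tri /slack !entry_Y' prednK //=; have [->|ne] := eqVneq q p;
      lia.
  apply: free_pos_eq.
  - by move: tri_ip; rewrite /in_tri; lia.
  - move=> hp1; rewrite u'E // eqxx.
    have e0 q : q < p -> excess (slack (lower Y i p) i)
        (shift_slack (lower Y i p) i) q = 0.
      elim: q => //= q IH hq; rewrite IH ?sub0n; last by lia.
      have := v0 q.+1 hq; rewrite /shift_slack /slack !entry_Y' prednK //; lia.
    by rewrite e0 //; lia.
  - by move=> q hq; rewrite u'E; move: tri_ip; rewrite /in_tri; lia.
exists i, (lower Y i p); split => //.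
apply: array_ext_all => c d; rewrite entry_crystal // entry_Y' Y'E.
case: (boolP ((c == i) && (d == p))) => hc; last by lia.
have [-> ->] : c = i /\ d = p by lia.
by move: hp; rewrite /slack prednK //=; lia.
Qed.

Definition weight n (Y : array n) :=
  \sum_(a < n.+1) \sum_(b < n.+1) entry Y a b.

Lemma weight_crystal n (Y : array n) i : 0 < i <= n ->
  weight Y < weight (crystal i Y).
Proof.
move=> hi; have := crystal_pos_tri Y hi; rewrite /in_tri => ht.
have hin : i < n.+1 by lia.
have hjn : crystal_pos Y i < n.+1 by lia.
rewrite /weight; under [X in _ < X]eq_bigr => a _.
  under eq_bigr => b _ do rewrite entry_crystal //.
  rewrite big_split /=; over.
rewrite big_split /= -[X in X < _]addn0 ltn_add2l.
rewrite (bigD1 (Ordinal hin)) //= (bigD1 (Ordinal hjn)) //= !eqxx; lia.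
Qed.

Lemma fourier_zero n (Y : array n) :
  (forall a b, entry Y a b = 0) -> forall a b, entry (fourier Y) a b = 0.
Proof.
elim: n Y => // n IH Y hY a b; rewrite fourierE.
have -> k : stage (A_exponent Y) (pad (fourier (del_ladder Y))) k =
    pad (fourier (del_ladder Y)).
  by elim: k => //= k ->; rewrite /A_exponent !hY; case: ifP.
rewrite entry_pad IH ?if_same // => i j.
by rewrite entry_del_ladder hY if_same.
Qed.

(** T T commutes with every f_i, and these operators generate all arrays from
    the zero array. *)
Lemma fourier_involutive n (Y : array n) : mono Y -> fourier (fourier Y) = Y.
Proof.
have [N] := ubnP (weight Y); elim: N Y => // N IH Y hN hY.
case: (boolP [exists a : 'I_n.+1, exists b : 'I_n.+1, 0 < entry Y a b]).
- case/existsP=> a /existsP[b hab].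
  have [i [Y' [hi hY' e]]] := crystal_surj hY hab.
  have [hT hTf] := fourier_crystal hY'.
  have [_ hTTf] := fourier_crystal hT.
  have hi' : 0 < n.+1 - i <= n by lia.
  rewrite e (hTf i hi).1 (hTTf _ hi').1 IH //.
    by congr crystal; lia.
  by have := weight_crystal Y' hi; rewrite -e; lia.
- move=> h; have hz a b : entry Y a b = 0.
    case: (boolP (in_tri n a b)) => hab; last by rewrite entry_out.
    have ha : a < n.+1 by move: hab; rewrite /in_tri; lia.
    have hb : b < n.+1 by move: hab; rewrite /in_tri; lia.
    apply/eqP; rewrite -leqn0 leqNgt; apply: contra h => h.
    by apply/existsP; exists (Ordinal ha); apply/existsP; exists (Ordinal hb).
  by apply: array_ext_all => a b; rewrite hz; do 2 apply: fourier_zero.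
Qed.

(** * B undoes A_k *)

Lemma ohead_filter_some (P : pred nat) a b j : a <= j < b -> P j ->
  (forall i, a <= i < j -> ~~ P i) ->
    ohead [seq x <- index_iota a b | P x] = Some j.
Proof.
move=> hj Pj nP; rewrite /index_iota.
have -> : b - a = (j - a) + (b - j.+1).+1 by lia.
rewrite iotaD filter_cat (_ : [seq x <- iota a (j - a) | P x] = [::]) /=.
  by rewrite subnKC ?Pj //; lia.
rewrite -(filter_pred0 (iota a (j - a))); apply: eq_in_filter => x.
by rewrite mem_iota => hx; apply/negbTE/nP; lia.
Qed.

Lemma ohead_filter_none (P : pred nat) a b :
  (forall i, a <= i < b -> ~~ P i) ->
    ohead [seq x <- index_iota a b | P x] = None.
Proof.
move=> nP; rewrite (_ : [seq x <- index_iota a b | P x] = [::]) //.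
rewrite -(filter_pred0 (index_iota a b)); apply: eq_in_filter => x.
by rewrite mem_index_iota => hx; apply/negbTE/nP.
Qed.

Lemma entry_del_top n (Y : array n.+1) a b :
  entry (del_top Y) a b = if 0 < a then entry Y a.+1 b else 0.
Proof.
rewrite entry_mkarray; case: ifP => h; first by case: ifP => //; move: h;
  rewrite /in_tri; lia.
by case: ifP => // ha; rewrite entry_out //; move: h; rewrite /in_tri; lia.
Qed.

(** The recursion of B passes to smaller arrays, where the chain of A_k is known
    only through its columns q; so the statement is about any chain of raises
    such that each step of it is the last possible one. *)
Lemma proc_B_chain n (X Y : array n) k k0 (q : nat -> nat) :
  mono X -> 0 < k <= n ->
  (forall r, 0 < r <= k -> 0 < q r <= n.+1 - k) ->
  (forall r, 0 < r < k -> q r <= q r.+1) ->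
  (forall r p, 0 < r <= k -> q r < p <= (if r < k then q r.+1 else n.+1 - r) ->
     slack X r p = 0) ->
  (forall a b, entry Y a b = entry X a b + ((0 < a <= k) && (b == q a))) ->
  k0 <= q 1 -> (forall p, k0 <= p < q 1 -> entry X 1 p = 0) ->
  proc_B Y k0 = (X, k).
Proof.
elim: n X Y k k0 q => [|n IH] X Y k k0 q hX hk hq hqq hs hY hk0 h0;
  first by lia.
have q1 := hq 1; have hI : invI Y k0 = Some (q 1).
  apply: ohead_filter_some; [lia|by rewrite hY; lia|].
  by move=> p hp; rewrite hY h0 //; lia.
rewrite /= hI.
have lowerE (W : array n.+1) : (forall a b, in_tri n.+1 a b -> entry W a b =
    entry X a b + ((a == 1) && (b == q 1))) -> lower W 1 (q 1) = X.
  move=> hW; apply: array_ext => a b hab; rewrite entry_mkarray hab hW //.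
  by case: ifP => ->; rewrite ?addn1 ?addn0.
have [k1|k_gt1] : k = 1 \/ 1 < k by lia.
- subst k; have -> : invJ Y k0 = None.
    rewrite /invJ hI; apply: ohead_filter_none => j hj; rewrite !hY.
    by have := hs 1 j isT; rewrite /slack /=; lia.
  by rewrite lowerE // => a b _; rewrite hY; have [->|ne] := eqVneq a 1; lia.
- have q2 := hq 2; have qq := hqq 1.
  have -> : invJ Y k0 = Some (q 2).+1.
    rewrite /invJ hI; apply: ohead_filter_some; first by lia.
    + by rewrite !hY /=; have := hX 1 (q 2); lia.
    + move=> j hj; rewrite !hY.
      by have := hs 1 j; rewrite k_gt1 /slack /=; lia.
  rewrite (IH (del_top X) (del_top Y) k.-1 (q 2).+1.-1 (fun r => q r.+1)) /=.
  + rewrite lowerE ?prednK //; first by lia.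
    move=> a b hab; rewrite entry_mkarray hab.
    case: eqP => [->|ne]; first by rewrite /top hY; lia.
    rewrite entry_del_top; move: hab; rewrite /in_tri => hab.
    have a_gt1 : 0 < a.-1 by lia.
    by rewrite a_gt1 prednK; lia.
  + move=> a b hb; rewrite !entry_del_top; case: ifP => // _; exact: hX.
  + lia.
  + by move=> r hr; have := hq r.+1; lia.
  + by move=> r hr; apply: hqq; lia.
  + move=> r p hr hp; have := hs r.+1 p; rewrite /slack !entry_del_top /=.
    have -> : 0 < r by lia.
    by move: hp; case: ifP; case: ifP; lia.
  + move=> a b; rewrite !entry_del_top hY; case: ifP; lia.
  + by [].
  + by move=> p; lia.
Qed.

(** B starts at the first nonzero entry of row 1, which is the one raised by A_k
    because row 1 vanished before it, and it stops in row k because A_k chose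
    the last possible column there. *)
Lemma proc_B_proc_A n (X : array n) k : mono X -> 0 < k <= n ->
  chain_pos X k 0 = 1 ->
  proc_B (proc_A k X) 1 = (X, k).
Proof.
move=> hX hk h1.
have bd r : 0 < r <= k -> [/\ 0 < chain_pos X k r, chain_pos X k r <= n.+1 - k &
    r < k -> chain_pos X k r <= chain_pos X k r.+1].
  by move=> hr; apply: chain_bounds; lia.
apply: (@proc_B_chain _ _ _ _ _ (chain_pos X k)) => //.
- by move=> r /bd[]; lia.
- by move=> r hr; have [|_ _] := bd r; lia.
- by move=> r p hr hp; apply: (@chain_slack0 n X k) => //; lia.
- by move=> a b; rewrite entry_proc_A //; lia.
- by have [] := bd 1; lia.
- move=> p hp; have k_gt0 : 0 < k by lia.
  have := @chain_slack0 n X k 0 p.+1 isT.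
  by rewrite k_gt0 h1 /slack /= [entry X 0 _]entry_out // subn0; apply; lia.
Qed.

(** The first row is recorded because T' reads the number of steps from it. *)
Definition orbit_spec n (X : array n) s (cnt : nat -> nat) Z :=
  [/\ row_sum X 1 = row_sum Z 1 + s, (B_orbit X s).1 = Z &
   forall j, count (fun m => j <= (B_orbit X m).2) (index_iota 1 s.+1) = cnt j].

Lemma orbit_spec_proc_A n (X Z : array n) k s cnt :
  mono X -> 0 < k <= n -> chain_pos X k 0 = 1 -> orbit_spec X s cnt Z ->
  orbit_spec (proc_A k X) s.+1 (fun j => (j <= k) + cnt j) Z.
Proof.
move=> hX hk h1 [sumX orbX cntX]; have BA := proc_B_proc_A hX hk h1.
have shift m : B_orbit (proc_A k X) m.+2 = B_orbit X m.+1.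
  by rewrite /B_orbit iterSr [in LHS]iterSr [in RHS]iterSr /= BA.
have one : B_orbit (proc_A k X) 1 = (X, k) by rewrite /B_orbit /= BA.
split.
- rewrite addnS -sumX /row_sum.
  have [|g1 g2 g3] := @chain_bounds n X k 1; first by lia.
  have hkn : k <= n by lia.
  under eq_bigr => j _ do rewrite entry_proc_A //.
  rewrite big_split -[in RHS]addn1; congr (_ + _) => /=.
  rewrite (bigD1_seq (chain_pos X k 1)) ?iota_uniq ?mem_index_iota; try lia.
  rewrite eqxx big1 /= => [|j /negbTE ->]; last by rewrite andbF.
  by have -> : 0 < k by lia.
- by case: s sumX orbX cntX => [|s] _ orbX _; [rewrite one -orbX|rewrite shift].
- move=> j; rewrite -cntX /index_iota !subSS !subn0.
  transitivity ((j <= (B_orbit (proc_A k X) 1).2) +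
    count (fun m => j <= (B_orbit (proc_A k X) m).2) (iota (1 + 1) s));
      first by [].
  rewrite one iotaDl count_map; congr (_ + _).
  apply: eq_in_count => -[|m]; rewrite mem_iota // => _.
  by change ((j <= (B_orbit (proc_A k X) m.+2).2) = (j <= (B_orbit X m.+1).2));
    rewrite shift.
Qed.

Lemma orbit_spec_stage n c (Z : array n) k : mono Z ->
  (forall p, entry Z 1 p = 0) -> k <= n ->
  orbit_spec (stage c Z k) (\sum_(1 <= i < k.+1) c i)
    (fun j => \sum_(1 <= i < k.+1) (j <= i) * c i) Z.
Proof.
move=> hZ hZ1; elim: k => [_|k IH hk].
  rewrite big_geq //; split; rewrite ?addn0 // => j.
  by rewrite big_geq.
have [h1 h2] := stage_inv c hZ hZ1 (ltnW hk).
have hfree : row1_free k.+1 (stage c Z k) by move=> k' hk'; apply: h2; lia.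
have {}IH := IH (ltnW hk).
suff H t : orbit_spec (iter t (proc_A k.+1) (stage c Z k))
    (\sum_(1 <= i < k.+1) c i + t)
    (fun j => \sum_(1 <= i < k.+1) (j <= i) * c i + (j <= k.+1) * t) Z.
  have [e1 e2 e3] := H (c k.+1).
  rewrite big_nat_recr //=; split=> // j.
  by rewrite [RHS]big_nat_recr //= -e3.
elim: t => [|t [IHt1 IHt2 IHt3]].
  by case: IH => e1 e2 e3; rewrite addn0; split=> // j; rewrite muln0 addn0.
have [|i1 i2] := @iter_proc_A_inv n (stage c Z k) k.+1 t h1 _ hfree;
  first by lia.
have [||e1 e2 e3] :=
  @orbit_spec_proc_A n _ Z k.+1 _ _ i1 _ _ (And3 IHt1 IHt2 IHt3).
- by lia.
- by apply: i2; lia.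
by rewrite addnS; split=> // j; rewrite mulnS addnCA -e3.
Qed.

(** The exponents are the differences of consecutive entries of the last
    ladder. *)
Lemma sum_A_exponent n (Y : array n) j : mono Y -> 0 < j <= n ->
  \sum_(1 <= i < n.+1) (j <= i) * A_exponent Y i = entry Y (n.+1 - j) j.
Proof.
move=> hY hj.
suff H k : j <= k.+1 -> k <= n ->
    \sum_(1 <= i < k.+1) (j <= i) * A_exponent Y i + entry Y (n - k) k.+1 =
    entry Y (n.+1 - j) j.
  by have := H n; rewrite subnn [entry Y 0 _]entry_out // addn0; apply; lia.
elim: k => [|k IH] h1 h2.
  rewrite big_geq // add0n; have -> : j = 1 by lia.
  by rewrite subn0 subn1.
have [jk|jk] := eqVneq j k.+2.
  rewrite big_nat big1 ?add0n; first by rewrite jk subSS.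
  by move=> i hi; have -> : (j <= i) = false by lia.
rewrite big_nat_recr //= -IH; try lia.
rewrite -addnA; congr (_ + _); have -> : j <= k.+1 by lia.
rewrite mul1n A_exponentE ?slackK //.
by congr entry; lia.
Qed.

(** The steps of B take T Y back to the padded transform of the array without
    its last ladder, and the ladder is recovered from the returned values. *)
Lemma fourierK n (Y : array n) : mono Y -> inv_fourier (fourier Y) = Y.
Proof.
elim: n Y => // n IH Y hY; have hY0 := del_ladder_mono hY.
have [hT _] := fourier_crystal hY0.
have e0 := IH _ hY0.
case: n Y hY hY0 hT e0 {IH} => [|n] Y hY hY0 hT e0; first by [].
have [] := @orbit_spec_stage _ (A_exponent Y) (pad (fourier (del_ladder Y)))
  n.+2.
- exact: pad_mono.
- by move=> p; rewrite entry_pad.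
- by [].
rewrite -fourierE; set X := fourier Y => sumX orbX cntX.
have pad1 : row_sum (pad (fourier (del_ladder Y))) 1 = 0.
  by rewrite /row_sum big1 // => j _; rewrite entry_pad.
rewrite pad1 add0n in sumX.
change (inv_fourier X) with
  (cup_ladder (inv_fourier (del_top (B_orbit X (row_sum X 1)).1))
    (fun j => count (fun m => j <= (B_orbit X m).2)
                    (index_iota 1 (row_sum X 1).+1))).
rewrite sumX orbX.
have -> : del_top (pad (fourier (del_ladder Y))) = fourier (del_ladder Y).
  apply: array_ext => a b; rewrite /in_tri => hab.
  by rewrite entry_del_top entry_pad ltnS; have -> : 0 < a by lia.
rewrite e0; apply: array_ext => a b hab; rewrite entry_mkarray hab.
move: hab; rewrite /in_tri => hab.
case: eqP => hc; last by rewrite entry_del_ladder; case: ifP => //; lia.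
rewrite cntX sum_A_exponent //; last by lia.
by congr entry; lia.
Qed.

(** * Conclusion *)

Theorem corollary6p6 (n : nat) (hn : 1 <= n) (w : n.-tuple nat) (Y : array n)
  (hY : in_P w Y) : fourier Y = inv_fourier Y.
Proof.
have hm := in_P_mono hY; have [hT _] := fourier_crystal hm.
by rewrite -[in RHS](fourier_involutive hm) fourierK.
Qed.
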